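(* Let Assumption 1 hold, let $\lambda>0$, let $\|\phi(s,a)\|_2\le1$ for all $(s,a)\in\mathcal X$, and let the data $\{(s_t,a_t,s_t',r_t')\}_{t=1}^N$ be adapted to a filtration $\{\mathcal F_t\}$ (i.e. $\{(s_\tau,a_\tau,s_\tau',r_\tau')\}_{\tau\le t}$ is $\mathcal F_t$-measurable), with $s_t'\sim p(\cdot\mid s_t,a_t)$ and $\mathbb E[r_t'\mid\cdot]=r(s_t,a_t)$, $r_t'\in[0,1]$, conditionally on $\mathcal F_{t-1}$ and $(s_t,a_t)$. Let $\omega:=\max\{\|w\|_2: 0\le\phi(s,a)^\top w\le1\ \forall(s,a)\in\mathcal X\}$. Then for any $\delta\in(0,1)$, with probability at least $1-\delta$, $$|v^\pi-\widehat v^\pi|\le\sum_{h=0}^H(H-h+1)\sqrt{(\widehat\nu_h^\pi)^\top\widehat\Sigma^{-1}\widehat\nu_h^\pi}\cdot\Big(\sqrt{2\lambda}\,\omega+2\sqrt{2d\ln\big(1+\tfrac{N}{\lambda d}\big)\ln\big(\tfrac{3N^2H}{\delta}\big)}+\tfrac43\ln\big(\tfrac{3N^2H}{\delta}\big)\Big),$$ where $\widehat\nu_h^\pi:=((\widehat M^\pi)^\top)^h\nu_0^\pi$.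
   Context: MDP setting: $\mathcal X=\mathcal S\times\mathcal A$; rewards $r'\in[0,1]$ with mean $r(s,a)$, next state $s'\sim p(\cdot\mid s,a)$; target policy $\pi$, horizon $H$, initial distribution $\xi_0$; $v^\pi=\mathbb E^\pi[\sum_{h=0}^Hr(s_h,a_h)\mid s_0\sim\xi_0]$. $\phi:\mathcal X\to\mathbb R^d$, $\mathcal Q=\{\phi^\top w\}$, $\phi^\pi(s)=\int\phi(s,a)\pi(a\mid s)da$, $\mathcal P^\pi f(s,a)=\mathbb E[f(s',a')\mid s,a]$ with $s'\sim p(\cdot\mid s,a),a'\sim\pi(\cdot\mid s')$. Assumption 1: $r\in\mathcal Q$ and $\mathcal P^\pi\mathcal Q\subseteq\mathcal Q$. Estimator: $\widehat\Sigma=\lambda I+\sum_t\phi(s_t,a_t)\phi(s_t,a_t)^\top$, $\widehat R=\widehat\Sigma^{-1}\sum_tr_t'\phi(s_t,a_t)$, $\widehat M^\pi=\widehat\Sigma^{-1}\sum_t\phi(s_t,a_t)\phi^\pi(s_t')^\top$, $\nu_0^\pi=\mathbb E[\phi(s,a)\mid s\sim\xi_0,a\sim\pi(\cdot\mid s)]$, $\widehat w_{H+1}^\pi=0$, $\widehat w_h^\pi=\widehat R+\widehat M^\pi\widehat w_{h+1}^\pi$ ($h=H,\dots,0$), $\widehat v^\pi=(\nu_0^\pi)^\top\widehat w_0^\pi$. *)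

(* Defs.v *)
From HB Require Import structures.
From mathcomp Require Import all_boot all_order all_algebra.
From mathcomp Require Import all_classical all_reals all_analysis.
Set Implicit Arguments. Unset Strict Implicit. Unset Printing Implicit Defensive.
Import Order.TTheory GRing.Theory Num.Theory.
Local Open Scope classical_set_scope.
Local Open Scope ring_scope.

Section LinearOPE.
Context {R : realType} {dS dA : measure_display}
  {S : measurableType dS} {A : measurableType dA} {d : nat}.

Definition dotv (u v : 'cV[R]_d) : R := (u^T *m v) 0 0.
Definition norm2 (v : 'cV[R]_d) : R := Num.sqrt (dotv v v).

Definition phi_pi (pi : R.-pker S ~> A) (phi : S * A -> 'cV[R]_d) (s : S)
  : 'cV[R]_d :=
  \col_i Rintegral (pi s) setT (fun a => phi (s, a) i 0).

Definition nu0 (xi0 : probability S R) (pi : R.-pker S ~> A)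
  (phi : S * A -> 'cV[R]_d) : 'cV[R]_d :=
  \col_i Rintegral xi0 setT (fun s => phi_pi pi phi s i 0).

Definition Ppi (p : R.-pker (S * A)%type ~> S) (pi : R.-pker S ~> A)
  (f : S * A -> R) (x : S * A) : R :=
  Rintegral (p x) setT (fun s' => Rintegral (pi s') setT (fun a' => f (s', a'))).

(* Q-functions by backward recursion: Qk k = sum_{j<k} (P^pi)^j r,
   i.e. Q_h = Qk (H+1-h), with Q_{H+1} = 0 and Q_h = r + P^pi Q_{h+1}. *)
Definition Qk (p : R.-pker (S * A)%type ~> S) (pi : R.-pker S ~> A)
  (r : S * A -> R) (k : nat) : S * A -> R :=
  iter k (fun f x => r x + Ppi p pi f x) (fun _ => 0).

(* v^pi = E^pi[ sum_{h=0}^H r(s_h,a_h) | s_0 ~ xi0 ], a_h ~ pi(.|s_h),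
   s_{h+1} ~ p(.|s_h,a_h), written as iterated integrals. *)
Definition vpi (xi0 : probability S R) (p : R.-pker (S * A)%type ~> S)
  (pi : R.-pker S ~> A) (r : S * A -> R) (H : nat) : R :=
  Rintegral xi0 setT (fun s =>
    Rintegral (pi s) setT (fun a => Qk p pi r H.+1 (s, a))).

Definition Sigma_hat (lam : R) (N : nat) (phi : S * A -> 'cV[R]_d)
  (x : nat -> S * A) : 'M[R]_d :=
  lam%:M + \sum_(1 <= t < N.+1) (phi (x t) *m (phi (x t))^T).

Definition R_hat (lam : R) (N : nat) (phi : S * A -> 'cV[R]_d)
  (x : nat -> S * A) (rr : nat -> R) : 'cV[R]_d :=
  invmx (Sigma_hat lam N phi x) *m \sum_(1 <= t < N.+1) (rr t *: phi (x t)).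

Definition M_hat (pi : R.-pker S ~> A) (lam : R) (N : nat)
  (phi : S * A -> 'cV[R]_d) (x : nat -> S * A) (s' : nat -> S) : 'M[R]_d :=
  invmx (Sigma_hat lam N phi x) *m
    \sum_(1 <= t < N.+1) (phi (x t) *m (phi_pi pi phi (s' t))^T).

(* w_hat_{H+1} = 0, w_hat_h = R_hat + M_hat w_hat_{h+1}; w_hat_0 is
   obtained after H+1 steps. *)
Definition w_hat0 (Rh : 'cV[R]_d) (Mh : 'M[R]_d) (H : nat) : 'cV[R]_d :=
  iter H.+1 (fun w => Rh + Mh *m w) 0.

Definition nu_hat (Mh : 'M[R]_d) (nu : 'cV[R]_d) (h : nat) : 'cV[R]_d :=
  iter h (fun v => Mh^T *m v) nu.

End LinearOPE.

Section Prob.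
Context {R : realType} {d0 : measure_display} {Omega : measurableType d0}.

Definition filtration (F : nat -> set (set Omega)) : Prop :=
  (forall t, sigma_algebra setT (F t)) /\
  (forall t, F t `<=` measurable) /\
  (forall t, F t `<=` F t.+1).

Definition measurable_wrt {dT} {T : measurableType dT}
  (G : set (set Omega)) (f : Omega -> T) : Prop :=
  forall B, measurable B -> G (f @^-1` B).

End Prob.

(* Main.v *)
Require Import Defs.
From HB Require Import structures.
From mathcomp Require Import all_boot all_order all_algebra.
From mathcomp Require Import all_classical all_reals all_analysis.
From mathcomp Require Import measurable_realfun ring lra.
Import Order.TTheory GRing.Theory Num.Theory.
Import numFieldNormedType.Exports.
Local Open Scope classical_set_scope.
Local Open Scope ring_scope.
Set Implicit Arguments. Unset Strict Implicit. Unset Printing Implicit Defensive.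

(** By Bellman closedness the Q-function with [k] stages to go is linear,
    [Q_k = phi^T W_k], and unrolling the regression recursion gives
    [v - vhat = \sum_h nu_h^T e_h], where each residual is
    [e_h = Sigma^-1 (lam W + k S)] and [S = \sum_t eta_t phi_t] is a sum of
    conditionally centered temporal differences normalized to [-1, 1].
    Cauchy-Schwarz for [Sigma^-1] reduces the claim to a bound on the
    self-normalized energy [S^T Sigma^-1 S].

    With [Sigma_t], [S_t] the partial sums up to time [t],
    [q = phi_{t+1}^T Sigma_t^-1 phi_{t+1}] and
    [u = phi_{t+1}^T Sigma_t^-1 S_t], Sherman-Morrison shows that the energy
    increases by [(2 eta u + eta^2 q - u^2) / (1 + q)].  Using [eta^2 <= 1],
    [cosh x <= exp (x^2 / 2)] and [q / (1 + q) <= ln (1 + q)], the process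
    [exp ((S_t^T Sigma_t^-1 S_t - \sum_{i < t} ln (1 + q_i)) / 2)] is a
    nonnegative supermartingale, so Markov's inequality at time [N] and a union
    bound over the stages give the energy bound
    [ln (det Sigma / lam^d) + 2 ln ((H + 1) / delta)].  Finally
    [det Sigma <= (tr Sigma / d)^d <= (lam + N / d)^d] by Hadamard's inequality
    and AM-GM. *)

(** * Positive semidefinite forms and determinants *)

Section Vectors.
Context {R : realType} {d : nat}.
Implicit Types (u v w phi : 'cV[R]_d) (A K M : 'M[R]_d).

Lemma dotvE u v : dotv u v = \sum_i u i 0 * v i 0.
Proof. by rewrite /dotv mxE; apply: eq_bigr => i _; rewrite mxE. Qed.

Lemma dotvC u v : dotv u v = dotv v u.
Proof. by rewrite !dotvE; apply: eq_bigr => i _; rewrite mulrC. Qed.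

Lemma dotvDr u v w : dotv u (v + w) = dotv u v + dotv u w.
Proof. by rewrite /dotv mulmxDr mxE. Qed.

Lemma dotvDl u v w : dotv (v + w) u = dotv v u + dotv w u.
Proof. by rewrite dotvC dotvDr !(dotvC u). Qed.

Lemma dotvZr (c : R) u v : dotv u (c *: v) = c * dotv u v.
Proof. by rewrite /dotv -scalemxAr mxE. Qed.

Lemma dotvZl (c : R) u v : dotv (c *: u) v = c * dotv u v.
Proof. by rewrite dotvC dotvZr dotvC. Qed.

Lemma dotvNr u v : dotv u (- v) = - dotv u v.
Proof. by rewrite /dotv mulmxN mxE. Qed.

Lemma dotvBr u v w : dotv u (v - w) = dotv u v - dotv u w.
Proof. by rewrite dotvDr dotvNr. Qed.

Lemma dotv0 u : dotv u 0 = 0.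
Proof. by rewrite /dotv mulmx0 mxE. Qed.

Lemma dotv_sumr (I : Type) (r : seq I) (F : I -> 'cV[R]_d) u :
  dotv u (\sum_(i <- r) F i) = \sum_(i <- r) dotv u (F i).
Proof.
elim/big_rec2: _ => [|i y x _ <-]; [exact: dotv0 | exact: dotvDr].
Qed.

Lemma dotv_mulmxr u M v : dotv u (M *m v) = dotv (M^T *m u) v.
Proof. by rewrite /dotv trmx_mul trmxK mulmxA. Qed.

Lemma mulmx_outer u v w : u *m v^T *m w = dotv v w *: u.
Proof.
rewrite -mulmxA (mx11_scalar (v^T *m w)) mul_mx_scalar.
by [].
Qed.

Lemma dotvv_ge0 v : 0 <= dotv v v.
Proof. by rewrite dotvE; apply: sumr_ge0 => i _; rewrite -expr2 sqr_ge0. Qed.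

Lemma dotvv_gt0 v : v != 0 -> 0 < dotv v v.
Proof.
move=> v0; rewrite lt_neqAle dotvv_ge0 andbT eq_sym; apply: contra v0.
rewrite dotvE psumr_eq0; last by move=> i _; rewrite -expr2 sqr_ge0.
move=> /allP h; apply/eqP/colP => i; rewrite mxE.
have /h : i \in index_enum 'I_d by rewrite mem_index_enum.
by rewrite -expr2 sqrf_eq0 => /eqP.
Qed.

Lemma sqr_norm2 v : norm2 v ^+ 2 = dotv v v.
Proof. by rewrite sqr_sqrtr // dotvv_ge0. Qed.

Lemma norm2_ge0 v : 0 <= norm2 v.
Proof. exact: sqrtr_ge0. Qed.

Lemma norm2Z (c : R) v : norm2 (c *: v) = `|c| * norm2 v.
Proof.
by rewrite /norm2 dotvZl dotvZr mulrA -expr2 sqrtrM ?sqr_ge0 // sqrtr_sqr.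
Qed.

(** Symmetry is part of the definition, because nonnegativity of a real quadratic form does not
    imply it. *)
Definition psd K := K^T = K /\ forall v, 0 <= dotv v (K *m v).

Lemma psd_scalar (c : R) : 0 <= c -> psd c%:M.
Proof.
move=> c0; split=> [|v]; first exact: tr_scalar_mx.
by rewrite mul_scalar_mx dotvZr mulr_ge0 // dotvv_ge0.
Qed.

Lemma psd_sym K u v : psd K -> dotv u (K *m v) = dotv v (K *m u).
Proof. by case=> sK _; rewrite dotv_mulmxr sK dotvC. Qed.

(** The form is nonnegative at every [b *: u + c *: v], and one choice of coefficients gives the
    discriminant. Since [K] may be singular, a direction [v] of zero energy needs a separate
    choice. *)
Lemma psd_CauchySchwarz K u v : psd K ->
  dotv u (K *m v) ^+ 2 <= dotv u (K *m u) * dotv v (K *m v).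
Proof.
move=> pK; have [_ K0] := pK.
have quad (b c : R) : 0 <= b ^+ 2 * dotv u (K *m u)
    + 2 * b * c * dotv u (K *m v) + c ^+ 2 * dotv v (K *m v).
  have := K0 (b *: u + c *: v).
  rewrite mulmxDr -!scalemxAr !dotvDl !dotvDr !dotvZl !dotvZr (psd_sym v u pK).
  by congr (_ <= _); ring.
have := K0 u; have := K0 v.
move: quad; set a := dotv u (K *m u); set b := dotv v (K *m v).
set c := dotv u (K *m v) => quad b0 a0.
move: b0; rewrite le_eqVlt => /predU1P [b0|b0].
  rewrite -b0 mulr0; have [->|c0] := eqVneq c 0; first by rewrite expr0n.
  (* With [b = 0] the quadratic is affine in its second coefficient; this value of it makes the
     whole expression equal to -1, a contradiction. *)
  have := quad 1 (- (a + 1) / (2 * c)); rewrite -b0.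
  have -> : 1 ^+ 2 * a + 2 * 1 * (- (a + 1) / (2 * c)) * c
      + (- (a + 1) / (2 * c)) ^+ 2 * 0 = -1 by field.
  by lra.
(* Up to scaling, these coefficients give the minimizer along [v]; what remains is [b] times the
   discriminant. *)
have := quad b (- c).
have -> : b ^+ 2 * a + 2 * b * - c * c + (- c) ^+ 2 * b = b * (a * b - c ^+ 2).
  by ring.
by rewrite pmulr_rge0 // subr_ge0.
Qed.

Lemma psd_normCauchySchwarz K u v : psd K ->
  `|dotv u (K *m v)| <=
    Num.sqrt (dotv u (K *m u)) * Num.sqrt (dotv v (K *m v)).
Proof.
move=> pK; have [_ K0] := pK; rewrite -sqrtrM ?K0 // -sqrtr_sqr.
by rewrite ler_wsqrtr // psd_CauchySchwarz.
Qed.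

Lemma dotv_le_norm2 u v : `|dotv u v| <= norm2 u * norm2 v.
Proof.
have := psd_normCauchySchwarz u v (psd_scalar ler01).
by rewrite !mul1mx.
Qed.

(* The Sherman-Morrison formula for the inverse of a rank-one update. *)
Definition sm_update K phi : 'M[R]_d :=
  K - (1 + dotv phi (K *m phi))^-1 *: (K *m phi *m (K *m phi)^T).

Lemma sm_updateE K phi v : K^T = K -> sm_update K phi *m v =
  K *m v - ((1 + dotv phi (K *m phi))^-1 * dotv phi (K *m v)) *: (K *m phi).
Proof.
move=> sK; rewrite mulmxBl -scalemxAl mulmx_outer scalerA.
by rewrite (dotv_mulmxr phi K v) sK.
Qed.

Lemma sm_update_quad K phi v : psd K -> dotv v (sm_update K phi *m v) =
  dotv v (K *m v) - dotv phi (K *m v) ^+ 2 / (1 + dotv phi (K *m phi)).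
Proof.
move=> pK; have [sK _] := pK.
rewrite sm_updateE // dotvBr dotvZr (psd_sym v phi) //; congr (_ - _); ring.
Qed.

Lemma sm_update_psd K phi : psd K -> psd (sm_update K phi).
Proof.
move=> pK; have [sK K0] := pK; split=> [|v].
  by rewrite /sm_update linearB linearZ /= trmx_mul trmxK sK.
rewrite sm_update_quad // subr_ge0.
have q0 := K0 phi; rewrite ler_pdivrMr; last by lra.
apply: le_trans (psd_CauchySchwarz phi v pK) _.
by rewrite mulrC; apply: ler_wpM2l => //; lra.
Qed.

Lemma sm_update_le K phi v : psd K ->
  dotv v (sm_update K phi *m v) <= dotv v (K *m v).
Proof.
move=> pK; have [_ K0] := pK; rewrite sm_update_quad // lerBlDr lerDl.
by rewrite divr_ge0 ?sqr_ge0 // addr_ge0.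
Qed.

Lemma sm_update_inv A K phi : psd K -> A *m K = 1%:M ->
  (A + phi *m phi^T) *m sm_update K phi = 1%:M.
Proof.
move=> [sK K0] AK; rewrite /sm_update mulmxBr -scalemxAr.
have -> : (A + phi *m phi^T) *m K = 1%:M + phi *m (K *m phi)^T.
  by rewrite mulmxDl AK trmx_mul sK mulmxA.
have -> : (A + phi *m phi^T) *m (K *m phi *m (K *m phi)^T)
   = (1 + dotv phi (K *m phi)) *: (phi *m (K *m phi)^T).
  rewrite mulmxA mulmxDl mulmxA AK mul1mx mulmx_outer.
  by rewrite -{1}(scale1r phi) -scalerDl scalemxAl.
rewrite scalerA mulVf ?scale1r ?addrK //.
by rewrite gt_eqF // ltr_pwDl.
Qed.

Lemma sm_update_step K phi v (eta : R) : psd K ->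
  let q := dotv phi (K *m phi) in let u := dotv phi (K *m v) in
  dotv (v + eta *: phi) (sm_update K phi *m (v + eta *: phi)) =
  dotv v (K *m v) + (2 * eta * u + eta ^+ 2 * q - u ^+ 2) / (1 + q).
Proof.
move=> pK q u; have [_ K0] := pK.
rewrite sm_update_quad // mulmxDr -scalemxAr !dotvDl !dotvDr !dotvZl !dotvZr.
rewrite (psd_sym v phi pK) -/q -/u.
by have q0 : 1 + q != 0; [rewrite gt_eqF // ltr_pwDl ?K0 | field].
Qed.

(** The bordered matrix [B] is triangularized in two ways: row elimination exposes
    [A + phi *m phi^T], column elimination through [K] exposes [1 + phi^T *m (K *m phi)] next to
    [A]. Both elimination factors have determinant 1. *)
Lemma det_rank1_update A K phi : A *m K = 1%:M ->
  \det (A + phi *m phi^T) = \det A * (1 + dotv phi (K *m phi)).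
Proof.
move=> AK; pose B : 'M[R]_(1 + d) := block_mx 1%:M (- phi^T) phi A.
have e1 : block_mx 1%:M 0 (- phi) 1%:M *m B =
          block_mx 1%:M (- phi^T) 0 (A + phi *m phi^T).
  rewrite mulmx_block !mul1mx !mul0mx !addr0 mulmx1 addNr.
  by rewrite mulNmx mulmxN opprK addrC.
have e2 : B *m block_mx 1%:M 0 (- (K *m phi)) 1%:M =
          block_mx (1%:M + phi^T *m (K *m phi)) (- phi^T) 0 A.
  rewrite mulmx_block !mulmx1 !mulmx0 !add0r mulmxN mulNmx opprK.
  by rewrite mulmxN (mulmxA A) AK mul1mx subrr.
have d1 := congr1 determinant e1; have d2 := congr1 determinant e2.
rewrite det_mulmx det_lblock det_ublock !det1 !mul1r in d1.
rewrite det_mulmx det_lblock det_ublock !det1 !mulr1 in d2.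
rewrite -d1 d2 det_mx11 mulrC; congr (_ * _).
by rewrite mxE /dotv !mxE.
Qed.

End Vectors.

Lemma posdef_diag_gt0 (R : realType) (n : nat) (A : 'M[R]_n) i :
  (forall v : 'cV[R]_n, v != 0 -> 0 < dotv v (A *m v)) -> 0 < A i i.
Proof.
move=> /(_ (delta_mx i 0)); rewrite /dotv trmx_delta -rowE -colE !mxE; apply.
by apply/eqP => /matrixP/(_ i 0); rewrite !mxE !eqxx => /eqP; rewrite oner_eq0.
Qed.

(* Hadamard's inequality, by induction on the size through the Schur
   complement of the top left entry. *)
Lemma det_le_prod_diag (R : realType) (n : nat) (A : 'M[R]_n) :
  A^T = A -> (forall v : 'cV[R]_n, v != 0 -> 0 < dotv v (A *m v)) ->
  0 < \det A <= \prod_i A i i.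
Proof.
elim: n A => [|n IHn]; first by move=> A *; rewrite det_mx00 big_ord0 ltr01 lexx.
rewrite -[n.+1]/(1 + n)%N => A sA pA.
pose a := A (lshift n 0) (lshift n 0); pose b := dlsubmx A; pose C := drsubmx A.
have ea : ulsubmx A = a%:M by rewrite [LHS]mx11_scalar !mxE.
have eb : ursubmx A = b^T by rewrite /b trmx_dlsub sA.
have sC : C^T = C by rewrite /C trmx_drsub sA.
have eA : A = block_mx a%:M b^T b C by rewrite -ea -eb submxK.
clearbody a b C; subst A.
have quad (x : R) (v : 'cV[R]_n) :
   dotv (col_mx x%:M v) (block_mx a%:M b^T b C *m col_mx x%:M v) =
   a * x ^+ 2 + 2 * x * dotv b v + dotv v (C *m v).
  have dotvM (y z : 'cV[R]_n) : y^T *m z = (dotv y z)%:M by exact: mx11_scalar.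
  rewrite mul_block_col {1}/dotv tr_col_mx mul_row_col tr_scalar_mx !mulmxDr.
  rewrite (mul_mx_scalar x b) -scalemxAr !dotvM (dotvC v b) -!scalar_mxM scale_scalar_mx.
  by rewrite -!raddfD /= mxE eqxx mulr1n; ring.
have a0 : 0 < a.
  have := pA (col_mx 1%:M 0); rewrite quad.
  rewrite mulmx0 !dotv0 mulr0 expr1n mulr1 !addr0; apply.
  by apply/eqP=> /(congr1 usubmx); rewrite col_mxKu linear0 => /matrixP/(_ 0 0);
     rewrite !mxE => /eqP; rewrite oner_eq0.
pose D : 'M[R]_n := C - a^-1 *: (b *m b^T).
have sD : D^T = D by rewrite /D linearB linearZ /= trmx_mul trmxK sC.
have pD (v : 'cV[R]_n) : v != 0 -> 0 < dotv v (D *m v).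
  (* This top coordinate minimizes the form for fixed [v], and the minimal value is the form of the
     Schur complement [D]. *)
  move=> v0; have := pA (col_mx (- a^-1 * dotv b v)%:M v).
  rewrite quad /D mulmxBl -scalemxAl mulmx_outer dotvBr !dotvZr (dotvC v b).
  have -> : a * (- a^-1 * dotv b v) ^+ 2 + 2 * (- a^-1 * dotv b v) * dotv b v
    + dotv v (C *m v) = dotv v (C *m v) - a^-1 * (dotv b v * dotv b v).
    by field; rewrite gt_eqF.
  apply; apply: contra v0 => /eqP/(congr1 dsubmx).
  by rewrite col_mxKd linear0 => ->.
have dA : \det (block_mx a%:M b^T b C) = a * \det D.
  have e : block_mx 1%:M 0 (- a^-1 *: b) 1%:M *m block_mx a%:M b^T b C
         = block_mx a%:M b^T 0 D.
    rewrite mulmx_block !mul1mx !mul0mx !addr0 mul_mx_scalar.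
    rewrite scalerA mulrN mulfV ?gt_eqF // scaleN1r addNr -scalemxAl scaleNr.
    by rewrite addrC.
  have := congr1 determinant e.
  by rewrite det_mulmx det_lblock det_ublock !det1 !mul1r det_scalar1.
have /andP[D0 DD] := IHn D sD pD.
rewrite dA mulr_gt0 //= big_split_ord big_ord1 /= block_mxEul.
rewrite [X in _ <= X * _]mxE eqxx mulr1n ler_pM2l //.
apply: (le_trans DD); apply: ler_prod => i _; apply/andP; split.
  exact/ltW/posdef_diag_gt0.
(* Each diagonal entry of [D] is that of [C] minus [b_i ^+ 2 / a]. *)
rewrite block_mxEdr /D [X in X <= _]mxE [X in _ + X <= _]mxE gerDl oppr_le0.
by rewrite !mxE big_ord1 !mxE mulr_ge0 ?invr_ge0 ?(ltW a0) // -expr2 sqr_ge0.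
Qed.

Lemma det_le_trace (R : realType) (n : nat) (A : 'M[R]_n) :
  A^T = A -> (forall v : 'cV[R]_n, v != 0 -> 0 < dotv v (A *m v)) ->
  0 < \det A <= (\tr A / n%:R) ^+ n.
Proof.
move=> sA pA; have /andP[-> h] := det_le_prod_diag sA pA; apply: (le_trans h).
have := @leif_AGM R 'I_n predT (fun i => A i i).
rewrite card_ord => -[i _|+ _] //.
exact/ltW/posdef_diag_gt0.
Qed.

(** * Scalar inequalities *)

Section RealInequalities.
Context {R : realType}.
Implicit Types (x y a b q u eta : R).

(** Taking the derivative through [is_derive] lets instance search compute it at each use, leaving
    only an algebraic identity to check. *)
Lemma ge0_is_derive_le (f df : R -> R) a b :
  (forall x, is_derive x 1 f (df x)) -> (forall x, a < x -> 0 <= df x) ->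
  a <= b -> f a <= f b.
Proof.
move=> fdf df0 ab.
have fd x : derivable f x 1 by have [] := fdf x.
apply: (@ger0_derive1_le_cc R f a b) => //; rewrite ?in_itv /= ?lexx ?ab //.
- move=> x; rewrite in_itv /= => /andP[ax _].
  by rewrite derive1E; have [_ ->] := fdf x; exact: df0.
- apply: continuous_subspaceT => x.
  exact/differentiable_continuous/derivable1_diffP.
Qed.

(** By evenness [x >= 0] may be assumed. Then [expR (- (t ^+ 2 / 2)) * cosh t] is nonincreasing for
    [t >= 0], because [sinh t <= t * cosh t] there, and it equals 1 at 0. *)
Lemma cosh_le_expR x : (expR x + expR (- x)) / 2 <= expR (x ^+ 2 / 2).
Proof.
wlog x0 : x / 0 <= x => [hw|].
  have [/hw//|/ltW x0] := leP 0 x.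
  by have := hw (- x); rewrite opprK sqrrN oppr_ge0 addrC => /(_ x0).
have sh y : 0 <= y -> expR y - expR (- y) <= y * (expR y + expR (- y)).
  move=> y0.
  (* The derivative of [f] is [t * (expR t - expR (- t))], nonnegative for [t > 0]. *)
  pose f (t : R) := t * (expR t + expR (- t)) - (expR t - expR (- t)).
  have : f 0 <= f y.
    apply: (@ge0_is_derive_le f (fun t => t * (expR t - expR (- t)))) => //.
      move=> t; apply: is_derive_eq.
      by rewrite /GRing.scale /=; ring.
    move=> t t0; apply: mulr_ge0; first exact: ltW.
    by rewrite subr_ge0 ler_expR; lra.
  by rewrite /f mul0r oppr0 subrr sub0r oppr0 subr_ge0.
pose g (t : R) := expR (- (t ^+ 2 / 2)) * (- (expR t + expR (- t))).
have : g 0 <= g x.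
  apply: (@ge0_is_derive_le g (fun t => expR (- (t ^+ 2 / 2)) *
    (t * (expR t + expR (- t)) - (expR t - expR (- t))))) => //.
    move=> t; apply: is_derive_eq.
    by rewrite /GRing.scale /=; field.
  move=> t t0; apply: mulr_ge0; first exact: expR_ge0.
  by rewrite subr_ge0 sh // ltW.
rewrite /g expr0n /= mul0r oppr0 expR0 mul1r expRN mulrN lerN2.
rewrite ler_pdivrMl ?expR_gt0 //; lra.
Qed.

(* The chord bound, as a convex combination of two tangent line bounds at
   [y * a]. *)
Lemma expR_le_chord y a : `|y| <= 1 ->
  expR (y * a) <= (expR a + expR (- a)) / 2 + y * ((expR a - expR (- a)) / 2).
Proof.
rewrite ler_norml => /andP[y1 y2].
have t b : expR (y * a) * (1 + (b - y * a)) <= expR b.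
  have -> : expR b = expR (y * a) * expR (b - y * a).
    by rewrite -expRD addrC subrK.
  by rewrite ler_pM2l ?expR_gt0 // expR_ge1Dx.
have := ler_wpM2l (_ : 0 <= (1 + y) / 2) (t a).
have := ler_wpM2l (_ : 0 <= (1 - y) / 2) (t (- a)).
set e := expR (y * a) => h1 h2.
have {}h1 := h1 ltac:(lra); have {}h2 := h2 ltac:(lra).
(* The weights [(1 + y) / 2] and [(1 - y) / 2] average [a] and [- a] to [y * a], so the slopes of
   the tangents cancel. *)
have -> : e = (1 + y) / 2 * (e * (1 + (a - y * a))) +
     (1 - y) / 2 * (e * (1 + (- a - y * a))) by field.
apply: le_trans (lerD h2 h1) _; lra.
Qed.

(** This is [ln (1 + x) <= x] at [x = - (q / (1 + q))], where [1 + x] is the inverse of [1 + q]. *)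
Lemma ln1D_ge q : 0 <= q -> q / (1 + q) <= ln (1 + q).
Proof.
move=> q0; have q1 : 0 < 1 + q by lra.
have := @le_ln1Dx R (- (q / (1 + q))) _.
have -> : 1 + - (q / (1 + q)) = (1 + q)^-1 by field; rewrite gt_eqF.
rewrite lnV ?posrE // lerN2; apply.
by rewrite ltrN2 ltr_pdivrMr //; lra.
Qed.

(* The coefficient of [eta] in the linear upper bound on one step of the
   exponential supermartingale. *)
Definition step_slope q u : R :=
  expR (((q - u ^+ 2) / (1 + q) - ln (1 + q)) / 2) *
  ((expR (u / (1 + q)) - expR (- (u / (1 + q)))) / 2).

(** Both exponentials making up the slope lie between 0 and [expR 1]. The bound provides the
    integrability needed to integrate the slope against the noise. *)
Lemma step_slope_norm q u : 0 <= q -> `|step_slope q u| <= expR 1.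
Proof.
move=> q0; have q1 : 0 < 1 + q by lra.
have ln_q := ln1D_ge q0.
rewrite normrM (ger0_norm (expR_ge0 _)).
set e := expR _; set k := u / (1 + q).
(* Here [s] is a sign: [(u - s) ^+ 2 >= 0] controls the terms in [u], and [ln1D_ge] the remaining
   ones. *)
have step (s : R) : s ^+ 2 = 1 -> e * expR (s * k) <= expR 1.
  move=> s1; rewrite -expRD ler_expR.
  have : (2 * (s * u) - u ^+ 2) / (1 + q) <= 1.
    by rewrite ler_pdivrMr //; have := sqr_ge0 (u - s); nra.
  have -> : (2 * (s * u) - u ^+ 2) / (1 + q) = 2 * (s * k) - u ^+ 2 / (1 + q).
    by rewrite /k; field; rewrite gt_eqF.
  rewrite mulrBl; lra.
have h1 : e * expR k <= expR 1 by rewrite -(mul1r k) step // expr1n.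
have h2 : e * expR (- k) <= expR 1 by rewrite -mulN1r step // sqrrN expr1n.
have e0 : 0 < e := expR_gt0 _.
have p1 : 0 < e * expR k by rewrite mulr_gt0 // expR_gt0.
have p2 : 0 < e * expR (- k) by rewrite mulr_gt0 // expR_gt0.
have -> : e * `|(expR k - expR (- k)) / 2| =
          `|(e * expR k - e * expR (- k)) / 2|.
  by rewrite -[e in LHS]gtr0_norm // -normrM; congr `|_|; ring.
by rewrite ler_norml; apply/andP; split; lra.
Qed.

(** The right-hand side is affine in [eta], so a centered [eta] leaves the constant 1. The bound
    [eta ^+ 2 <= 1] removes the quadratic term, the chord bound linearizes [expR (eta * k)], and the
    resulting constant term is at most 1. *)
Lemma expR_step_le q u eta : 0 <= q -> `|eta| <= 1 ->
  expR (((2 * eta * u + eta ^+ 2 * q - u ^+ 2) / (1 + q) - ln (1 + q)) / 2)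
    <= 1 + eta * step_slope q u.
Proof.
move=> q0 eta1; have q1 : 0 < 1 + q by lra.
have ln_q := ln1D_ge q0.
have eta2 : eta ^+ 2 <= 1.
  by rewrite -(expr1n _ 2) -[leLHS]real_normK ?num_real // lerXn2r // nnegrE.
pose k := u / (1 + q).
pose e := expR (((q - u ^+ 2) / (1 + q) - ln (1 + q)) / 2).
have e0 : 0 < e := expR_gt0 _.
have ineq1 : ((2 * eta * u + eta ^+ 2 * q - u ^+ 2) / (1 + q) - ln (1 + q)) / 2
   <= ((q - u ^+ 2) / (1 + q) - ln (1 + q)) / 2 + eta * k.
  have -> : eta * k = (2 * eta * u / (1 + q)) / 2.
    by rewrite /k; field; rewrite gt_eqF.
  have : (eta ^+ 2 * q) / (1 + q) <= q / (1 + q).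
    by rewrite ler_pM2r ?invr_gt0 //; nra.
  rewrite !mulrBl !mulrDl; lra.
have : expR (((2 * eta * u + eta ^+ 2 * q - u ^+ 2) / (1 + q) - ln (1 + q)) / 2)
   <= e * expR (eta * k) by rewrite -expRD ler_expR.
move=> /le_trans; apply.
have := ler_wpM2l (ltW e0) (expR_le_chord k eta1).
move=> /le_trans; apply.
rewrite mulrDr [e * (eta * _)]mulrCA lerD //.
(* The constant term is [e * cosh k]. Its exponent is nonpositive since [k ^+ 2 <= u ^+ 2 / (1 + q)]
   and [q / (1 + q) <= ln (1 + q)]. *)
apply: le_trans (ler_wpM2l (ltW e0) (cosh_le_expR k)) _.
rewrite -expRD -[leRHS]expR0 ler_expR.
have : k ^+ 2 <= u ^+ 2 / (1 + q).
  rewrite /k exprMn exprVn ler_wpM2l ?sqr_ge0 // lef_pV2 ?posrE ?exprn_gt0 //.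
  by rewrite expr2; nra.
rewrite mulrBl; lra.
Qed.

End RealInequalities.

(** * Regularized Gram matrices *)

Section RegularizedGram.
Context {R : realType} {d : nat}.
Variables (lam : R) (phi : nat -> 'cV[R]_d).
Hypothesis lam_gt0 : 0 < lam.
Implicit Types (t : nat) (v : 'cV[R]_d).

Definition gram t : 'M[R]_d :=
  lam%:M + \sum_(1 <= i < t.+1) phi i *m (phi i)^T.

(** A recursive inverse, so that positivity, monotonicity and measurability follow by induction over
    rank-one updates; [invmx_gram] identifies it with the matrix inverse. *)
Fixpoint gram_inv t : 'M[R]_d :=
  if t is t'.+1 then sm_update (gram_inv t') (phi t) else (lam^-1)%:M.

(** Index [t] pairs the inverse at time [t] with the incoming feature [t.+1], so the value does not
    involve the noise. *)
Definition leverage t : R := dotv (phi t.+1) (gram_inv t *m phi t.+1).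

(** By [det_gram] this is [ln (\det (gram t) / lam ^+ d)]. *)
Definition log_potential t : R := \sum_(i < t) ln (1 + leverage i).

Lemma gram_inv_psd t : psd (gram_inv t).
Proof.
elim: t => [|t IHt] /=; first by apply: psd_scalar; rewrite invr_ge0 ltW.
exact: sm_update_psd.
Qed.

Lemma leverage_ge0 t : 0 <= leverage t.
Proof. by have [_] := gram_inv_psd t; apply. Qed.

Lemma gramS t : gram t.+1 = gram t + phi t.+1 *m (phi t.+1)^T.
Proof. by rewrite /gram big_nat_recr //= addrA. Qed.

Lemma gram0 : gram 0 = lam%:M.
Proof. by rewrite /gram big_geq // addr0. Qed.

Lemma mul_gram_inv t : gram t *m gram_inv t = 1%:M.
Proof.
elim: t => [|t IHt]; first by rewrite gram0 /= -scalar_mxM mulfV // gt_eqF.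
by rewrite gramS sm_update_inv //; exact: gram_inv_psd.
Qed.

Lemma invmx_gram t : invmx (gram t) = gram_inv t.
Proof.
have h := mul_gram_inv t; have [gU _] := mulmx1_unit h.
by rewrite -[LHS]mulmx1 -h mulmxA mulVmx // mul1mx.
Qed.

Lemma gram_inv_le t v : dotv v (gram_inv t *m v) <= lam^-1 * dotv v v.
Proof.
elim: t => [|t IHt] /=; first by rewrite mul_scalar_mx dotvZr.
by apply: le_trans IHt; apply: sm_update_le; exact: gram_inv_psd.
Qed.

Lemma det_gram t : \det (gram t) = lam ^+ d * \prod_(i < t) (1 + leverage i).
Proof.
elim: t => [|t IHt]; first by rewrite gram0 det_scalar big_ord0 mulr1.
rewrite gramS (det_rank1_update _ (mul_gram_inv t)) IHt big_ord_recr /=.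
by rewrite mulrA.
Qed.

Lemma gram_sym t : (gram t)^T = gram t.
Proof.
rewrite /gram linearD /= tr_scalar_mx linear_sum /=; congr (_ + _).
by apply: eq_bigr => i _; rewrite trmx_mul trmxK.
Qed.

Lemma gram_posdef t v : v != 0 -> 0 < dotv v (gram t *m v).
Proof.
move=> v0; rewrite mulmxDl dotvDr mul_scalar_mx dotvZr ltr_pwDl //.
  by rewrite mulr_gt0 // dotvv_gt0.
rewrite mulmx_suml dotv_sumr sumr_ge0 // => i _.
by rewrite mulmx_outer dotvZr (dotvC v) -expr2 sqr_ge0.
Qed.

Lemma trace_gram t : (forall i, (1 <= i <= t)%N -> norm2 (phi i) <= 1) ->
  \tr (gram t) <= lam * d%:R + t%:R.
Proof.
move=> phi1; rewrite /gram raddfD /= mxtrace_scalar -[lam *+ d]mulr_natr lerD2l.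
rewrite raddf_sum /= -[leRHS](_ : \sum_(1 <= i < t.+1) 1 = _); last first.
  by rewrite sumr_const_nat subSS subn0.
apply: ler_sum_nat => i it.
rewrite mxtrace_mulC /mxtrace big_ord1 -/(dotv _ _) -sqr_norm2.
by rewrite expr_le1 // ?norm2_ge0 // phi1.
Qed.

Lemma log_potential_le t :
  (forall i, (1 <= i <= t)%N -> norm2 (phi i) <= 1) ->
  log_potential t <= d%:R * ln (1 + t%:R / (lam * d%:R)).
Proof.
(* In dimension zero all leverages vanish; the trace argument divides by [d%:R] and requires
   [d > 0]. *)
have [d0 _|d0 phi1] := posnP d.
  rewrite [log_potential t]big1 => [|i _]; last first.
    rewrite /leverage dotvE big1 ?addr0 ?ln1 // => j.
    by have := ltn_ord j; rewrite [X in (_ < X)%N]d0.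
  rewrite mulr_ge0 // ln_ge0 // lerDl divr_ge0 // mulr_ge0 // ltW //.
have d0' : 0 < d%:R :> R by rewrite ltr0n.
have /andP[det0 detle] := det_le_trace (gram_sym t) (@gram_posdef t).
have pot : log_potential t = ln (\prod_(i < t) (1 + leverage i)).
  rewrite /log_potential; elim: (t) => [|n IHn]; first by rewrite !big_ord0 ln1.
  rewrite !big_ord_recr /= lnM ?posrE ?IHn //.
    by apply: prodr_gt0 => i _; rewrite ltr_pwDl ?leverage_ge0.
  by rewrite ltr_pwDl ?leverage_ge0.
have base0 : 0 < 1 + t%:R / (lam * d%:R).
  by rewrite ltr_pwDl // divr_ge0 // mulr_ge0 // ltW.
rewrite pot mulr_natl -lnXn // ler_ln ?posrE ?exprn_gt0 //; last first.
  by apply: prodr_gt0 => i _; rewrite ltr_pwDl ?leverage_ge0.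
(* Multiplying by [lam ^+ d] turns the product of leverages into [\det (gram t)] and the target into
   a single [d]-th power. *)
rewrite -(ler_pM2l (exprn_gt0 d lam_gt0)) -det_gram -exprMn.
apply: le_trans detle _.
have tr0 : 0 <= \tr (gram t).
  apply: sumr_ge0 => i _; apply: ltW; apply: posdef_diag_gt0.
  exact: gram_posdef.
apply: lerXn2r.
- by rewrite nnegrE divr_ge0.
- by rewrite nnegrE mulr_ge0 // ltW.
rewrite ler_pdivrMr //.
apply: le_trans (trace_gram phi1) _.
by rewrite le_eqVlt; apply/orP; left; apply/eqP; field; rewrite !gt_eqF.
Qed.

Definition noise_sum (eta : nat -> R) t : 'cV[R]_d :=
  \sum_(1 <= i < t.+1) eta i *: phi i.

Definition noise_energy (eta : nat -> R) t : R :=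
  dotv (noise_sum eta t) (gram_inv t *m noise_sum eta t).

Definition drift (eta : nat -> R) t : R :=
  dotv (phi t.+1) (gram_inv t *m noise_sum eta t).

(** This is the Gaussian mixture, over directions [theta] with covariance [lam^-1 I], of
    [expR (theta^T S - theta^T V theta / 2)], where [S] is the noise sum and
    [V = gram t - lam I]. *)
Definition exp_potential (eta : nat -> R) t : R :=
  expR ((noise_energy eta t - log_potential t) / 2).

Lemma noise_sumS eta t :
  noise_sum eta t.+1 = noise_sum eta t + eta t.+1 *: phi t.+1.
Proof. by rewrite /noise_sum big_nat_recr. Qed.

Lemma exp_potential0 eta : exp_potential eta 0 = 1.
Proof.
rewrite /exp_potential /noise_energy /noise_sum big_geq // mulmx0 dotv0.
by rewrite /log_potential big_ord0 subrr mul0r expR0.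
Qed.

Lemma exp_potential_step eta t : `|eta t.+1| <= 1 ->
  exp_potential eta t.+1 <= exp_potential eta t *
    (1 + eta t.+1 * step_slope (leverage t) (drift eta t)).
Proof.
move=> eta1; rewrite /exp_potential /noise_energy /log_potential noise_sumS.
rewrite big_ord_recr /= sm_update_step; last exact: gram_inv_psd.
apply: le_trans (ler_wpM2l (expR_ge0 _) (expR_step_le _ (leverage_ge0 t) eta1)).
rewrite -expRD ler_expR le_eqVlt; apply/orP; left; apply/eqP.
rewrite -/(leverage t) -/(drift eta t); field.
by rewrite gt_eqF // ltr_pwDl ?leverage_ge0.
Qed.

(** A crude deterministic bound that makes the process integrable. *)
Lemma exp_potential_le eta t : (forall i, (1 <= i <= t)%N -> `|eta i| <= 1) ->
  exp_potential eta t <= (1 + expR 1) ^+ t.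
Proof.
elim: t => [_|t IHt eta1]; first by rewrite exp_potential0 expr0.
have et1 : `|eta t.+1| <= 1 by apply: eta1; rewrite /= ltnSn.
apply: le_trans (exp_potential_step et1) _; rewrite exprSr.
apply: le_trans (_ : exp_potential eta t * (1 + expR 1) <= _).
  rewrite ler_wpM2l ?expR_ge0 // lerD2l; apply: le_trans (ler_norm _) _.
  rewrite normrM -[leRHS]mul1r ler_pM //; apply: step_slope_norm.
  exact: leverage_ge0.
rewrite ler_wpM2r ?addr_ge0 ?expR_ge0 // IHt // => i /andP[i0 it].
by rewrite eta1 // i0 ltnW.
Qed.

End RegularizedGram.

(** * Bounded integrands *)

Section BoundedIntegrals.
Context {R : realType} {dT : measure_display} {T : measurableType dT}.
Implicit Types (f g : T -> R).

Lemma measurable_funZ (c : R) f :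
  measurable_fun setT f -> measurable_fun setT (fun x => c * f x).
Proof. by move=> mf; exact: (measurable_funM (@measurable_cst _ _ _ _ setT c) mf). Qed.

Lemma norm_indic_le1 (B : set T) x : `|\1_B x| <= 1 :> R.
Proof. by rewrite indicE; case: (_ \in _); rewrite ?normr1 ?normr0. Qed.

Lemma measurable_funV_gt0 f : measurable_fun setT f -> (forall x, 0 < f x) ->
  measurable_fun setT (fun x => (f x)^-1).
Proof.
move=> mf f0.
rewrite (_ : (fun _ => _) = (fun x => expR (- ln (f x)))); last first.
  by apply/funext => x; rewrite expRN lnK // posrE.
apply: (measurableT_comp (@measurable_expR R)).
apply: measurable_funN.
exact: measurableT_comp (@measurable_ln R) mf.
Qed.

(** The range is cut into finitely many slabs of height [e], and [f] is rounded down on each. For a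
    sub-sigma-algebra structure on the domain, the sets [B i] belong to that sub-sigma-algebra. *)
Lemma uniform_simple_approx f (K e : R) : measurable_fun setT f ->
  (forall x, `|f x| <= K) -> 0 < e ->
  exists (m : nat) (c : 'I_m -> R) (B : 'I_m -> set T),
    (forall i, measurable (B i)) /\
    (forall x, `|f x - \sum_i c i * \1_(B i) x| <= e).
Proof.
move=> mf fK e0.
pose k x := Num.truncn ((f x + K) / e).
have fK0 x : 0 <= (f x + K) / e.
  by apply: divr_ge0; [have := fK x; rewrite ler_norml; lra | exact: ltW].
have kP x : (k x)%:R * e <= f x + K < (k x).+1%:R * e.
  have /andP[h1 h2] := truncn_itv (fK0 x).
  by rewrite -ler_pdivlMr // h1 -ltr_pdivrMr.
pose m := (Num.truncn (2 * K / e)).+1.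
have km x : (k x < m)%N.
  rewrite ltnS; apply: le_truncn; rewrite ler_pM2r ?invr_gt0 //.
  by have := fK x; rewrite ler_norml; lra.
exists m, (fun i => i%:R * e - K),
  (fun i => f @^-1` `[i%:R * e - K, i.+1%:R * e - K[%classic).
split=> [i|x].
  by rewrite -[X in measurable X]setTI; apply: mf => //; exact: measurable_itv.
(* Each [x] lies in exactly one slab, so the sum reduces to one term. *)
have inB (i : 'I_m) : \1_(f @^-1` `[i%:R * e - K, i.+1%:R * e - K[%classic) x
    = (i == Ordinal (km x))%:R :> R.
  rewrite indicE; congr (_%:R : R); congr nat_of_bool; have /andP[k1 k2] := kP x.
  apply/idP/idP => [|/eqP ->]; rewrite ?inE /= ?in_itv /=; last first.
    by rewrite lerBlDr k1 ltrBrDr k2.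
  rewrite lerBlDr ltrBrDr => /andP[i1 i2]; rewrite -val_eqE /=.
  have := le_lt_trans i1 k2; have := le_lt_trans k1 i2.
  by rewrite !ltr_pM2r // !ltr_nat !ltnS eqn_leq => -> ->.
rewrite (bigD1 (Ordinal (km x))) // big1 ?addr0; last first.
  by move=> i /negbTE ik; rewrite inB ik mulr0.
rewrite (inB (Ordinal (km x))) eqxx mulr1 /=; have /andP[k1 k2] := kP x.
rewrite -natr1 in k2.
by rewrite ler_norml; apply/andP; split; lra.
Qed.

Variable mu : {measure set T -> \bar R}.
Hypothesis mu1 : (mu setT = 1)%E.

Let mu_fin : (mu setT < +oo)%E.
Proof. by rewrite mu1 ltry. Qed.

Lemma bounded_integrable f (K : R) (D : set T) : measurable_fun setT f ->
  (forall x, `|f x| <= K) -> measurable D -> mu.-integrable D (EFin \o f).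
Proof.
move=> mf fK mD; apply: measurable_bounded_integrable => //.
- by apply: le_lt_trans mu_fin; apply: le_measure; rewrite ?inE.
- exact: measurable_funS mf.
- exists K; split=> [|y /ltW Ky x _]; first exact: num_real.
  exact: le_trans (fK x) Ky.
Qed.

Lemma Rintegral_sum_integrable (I : Type) (r : seq I) (h : I -> T -> R)
    (D : set T) : measurable D ->
  (forall i, mu.-integrable D (EFin \o h i)) ->
  \int[mu]_(x in D) (\sum_(i <- r) h i x) = \sum_(i <- r) \int[mu]_(x in D) h i x.
Proof.
move=> mD ih; elim: r => [|i r IHr].
  by under eq_Rintegral do rewrite big_nil; rewrite Rintegral_cst // mul0r big_nil.
under eq_Rintegral do rewrite big_cons.
rewrite RintegralD // ?IHr ?big_cons //.
rewrite (_ : EFin \o _ = (fun x => \sum_(i <- r) (h i x)%:E)%E).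
  by apply: integrable_sum => // j _; exact: ih.
by apply/funext => x /=; rewrite sumEFin.
Qed.

Lemma normr_Rintegral_le f (K : R) (D : set T) : measurable D ->
  measurable_fun setT f -> (forall x, `|f x| <= K) ->
  `|\int[mu]_(x in D) f x| <= K.
Proof.
move=> mD mf fK.
(* Measurable types are pointed, so the bound can be evaluated somewhere. *)
have K0 : 0 <= K by apply: le_trans (fK point).
have intf := bounded_integrable mf fK mD.
apply: le_trans (le_normr_Rintegral mD intf) _.
apply: le_trans (_ : \int[mu]_(x in D) K <= _).
  apply: le_Rintegral => //.
  - exact: integrable_norm.
  - by apply: (@bounded_integrable _ `|K|).
rewrite Rintegral_cst // -[leRHS]mulr1 ler_wpM2l //.
have -> : 1 = fine (mu setT) by rewrite mu1.
apply: fine_le; rewrite ?mu1 //.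
- by rewrite ge0_fin_numE //; apply: le_lt_trans mu_fin; apply: le_measure; rewrite ?inE.
- by rewrite -mu1; apply: le_measure; rewrite ?inE.
Qed.

End BoundedIntegrals.

(** The concluding step of the approximation arguments; the sign of [K] is left free, hence the
    rescaling by [|K| + 1]. *)
Lemma eq0_of_norm_le_eps (R : realType) (x K : R) :
  (forall e, 0 < e -> `|x| <= e * K) -> x = 0.
Proof.
move=> h; apply/eqP; rewrite -normr_eq0 eq_le normr_ge0 andbT.
apply/ler_addgt0Pr => e e0; rewrite add0r.
have K1 : 0 < `|K| + 1 by rewrite ltr_pwDr.
apply: le_trans (h (e / (`|K| + 1)) (divr_gt0 e0 K1)) _.
rewrite mulrAC ler_pdivrMr // ler_pM2l //.
by apply: le_trans (ler_norm K) _; rewrite lerDl.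
Qed.

(** * Conditioning through sub-sigma-algebras and kernels *)

Section SubSigmaAlgebra.
Context {R : realType} {d0 : measure_display} {Omega : measurableType d0}.
Implicit Types (G : set (set Omega)) (f g : Omega -> R).

Lemma g_sigma_sub_measurable G : G `<=` measurable -> <<s G >> `<=` measurable.
Proof. by move=> GM; apply: smallest_sub => //; exact: sigma_algebra_measurable. Qed.

(** Measurability for the sub-sigma-algebra generated by [G] is expressed by retyping the domain as
    [g_sigma_algebraType G]. *)
Lemma measurable_fun_g_sigma {dT} {T : measurableType dT} G (f : Omega -> T) :
  G `<=` measurable ->
  measurable_fun setT (f : g_sigma_algebraType G -> T) -> measurable_fun setT f.
Proof.
move=> GM mf _ B mB; apply: (g_sigma_sub_measurable GM).
exact: mf measurableT B mB.
Qed.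

Lemma measurable_fun_g_sigmaS {dT} {T : measurableType dT}
    (G1 G2 : set (set Omega)) (f : Omega -> T) : G1 `<=` <<s G2 >> ->
  measurable_fun setT (f : g_sigma_algebraType G1 -> T) ->
  measurable_fun setT (f : g_sigma_algebraType G2 -> T).
Proof.
move=> G12 mf _ B mB; have : <<s G1 >> (setT `&` f @^-1` B).
  exact: mf measurableT B mB.
by apply: smallest_sub => //; exact: smallest_sigma_algebra.
Qed.

Variable P : probability Omega R.

Let P_fin : (P setT = 1)%E := probability_setT P.

Lemma Rintegral_indicM f (B : set Omega) :
  \int[P]_x (\1_B x * f x) = \int[P]_(x in B) f x.
Proof.
rewrite [RHS]Rintegral_mkcond; apply: eq_Rintegral => x _.
by rewrite patch_indic /= mulrC.
Qed.

(** The last hypothesis says that [f] has conditional mean zero. Linearity extends it from events to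
    simple functions, and uniform approximation of [g] costs at most [e * Kf]. *)
Lemma Rintegral_mul_eq0 G f g (Kf Kg : R) : G `<=` measurable ->
  measurable_fun setT f -> (forall x, `|f x| <= Kf) ->
  measurable_fun setT (g : g_sigma_algebraType G -> R) ->
  (forall x, `|g x| <= Kg) ->
  (forall E, <<s G >> E -> \int[P]_(x in E) f x = 0) ->
  \int[P]_x (g x * f x) = 0.
Proof.
move=> GM mf fK mg gK f0; apply: (@eq0_of_norm_le_eps _ _ Kf) => e e0.
have [m [c [B [mB gB]]]] : exists m (c : 'I_m -> R) (B : 'I_m -> set Omega),
    (forall i, <<s G >> (B i)) /\
    (forall x, `|g x - \sum_i c i * \1_(B i) x| <= e).
  by have := uniform_simple_approx mg gK e0.
have mBO i : measurable (B i) by exact: (g_sigma_sub_measurable GM).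
have mg' := measurable_fun_g_sigma GM mg.
have mI i : measurable_fun setT (fun x => c i * \1_(B i) x * f x).
  by apply: measurable_funM => //; exact/measurable_funZ/measurable_indic.
have msum : measurable_fun setT (fun x => \sum_i c i * \1_(B i) x * f x).
  exact: measurable_sum.
have IK i x : `|c i * \1_(B i) x * f x| <= `|c i| * Kf.
  rewrite !normrM ler_pM // -[leRHS]mulr1 ler_wpM2l //.
  exact: norm_indic_le1.
have int_sum : \int[P]_x (\sum_i c i * \1_(B i) x * f x) = 0.
  rewrite Rintegral_sum_integrable //; last first.
    by move=> i; exact: (bounded_integrable P_fin (mI i) (IK i)).
  apply: big1 => i _; under eq_Rintegral do rewrite -mulrA.
  rewrite RintegralZl //; last first.
    apply: (@bounded_integrable _ _ _ _ P_fin _ Kf) => //.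
      by apply: measurable_funM => //; exact: measurable_indic.
    move=> x; rewrite normrM -[leRHS]mul1r ler_pM //.
    exact: norm_indic_le1.
  by rewrite Rintegral_indicM f0 ?mulr0 //; exact: mB.
have gf x : `|g x * f x - \sum_i c i * \1_(B i) x * f x| <= e * Kf.
  by rewrite -mulr_suml -mulrBl normrM ler_pM.
have mgf : measurable_fun setT (fun x => g x * f x - \sum_i c i * \1_(B i) x * f x).
  by apply: measurable_funB => //; exact: measurable_funM.
have := normr_Rintegral_le P_fin measurableT mgf gf.
rewrite RintegralB //.
- by rewrite int_sum subr0.
- apply: (@bounded_integrable _ _ _ _ P_fin _ (Kg * Kf)) => //.
    exact: measurable_funM.
  by move=> x; rewrite normrM ler_pM.
- apply: (@bounded_integrable _ _ _ _ P_fin _ (\sum_i `|c i| * Kf)) => // x.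
  by apply: le_trans (ler_norm_sum _ _ _) _; apply: ler_sum => i _; exact: IK.
Qed.

(** The law of [Y] is given on events only; approximating [V] uniformly by simple functions extends
    it to bounded [V]. *)
Lemma Rintegral_kernel_law {dT dS} {T : measurableType dT}
    {S : measurableType dS} (k : R.-pker T ~> S) (X : Omega -> T)
    (Y : Omega -> S) (E : set Omega) (V : S -> R) (K : R) :
  measurable_fun setT X -> measurable_fun setT Y -> measurable E ->
  (forall B, measurable B -> P (E `&` Y @^-1` B) = \int[P]_(w in E) k (X w) B)%E ->
  measurable_fun setT V -> (forall s, `|V s| <= K) ->
  measurable_fun setT (fun w => \int[k (X w)]_s V s) ->
  \int[P]_(w in E) V (Y w) = \int[P]_(w in E) \int[k (X w)]_s V s.
Proof.
move=> mX mY mE law mV VK mkV; apply/eqP; rewrite -subr_eq0; apply/eqP.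
have k_fin x : (k x setT = 1)%E by rewrite prob_kernel.
have k_lty x : (k x setT < +oo)%E by rewrite k_fin ltry.
(* One error [e] arises on each side of the identity, hence the factor 2. *)
apply: (@eq0_of_norm_le_eps _ _ 2) => e e0.
have [m [c [B [mB VB]]]] := uniform_simple_approx mV VK e0.
pose Vs s := \sum_i c i * \1_(B i) s.
have mVs : measurable_fun setT Vs.
  by apply: measurable_sum => i; exact/measurable_funZ/measurable_indic.
have indK i s : `|c i * \1_(B i) s| <= `|c i|.
  rewrite normrM -[leRHS]mulr1 ler_wpM2l //.
  exact: norm_indic_le1.
have VsK s : `|Vs s| <= \sum_i `|c i|.
  by apply: le_trans (ler_norm_sum _ _ _) _; exact: ler_sum.
have mind i : measurable_fun setT (fun s => c i * \1_(B i) s).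
  exact/measurable_funZ/measurable_indic.
have Rint_indic (mu : {measure set S -> \bar R}) i : (mu setT = 1)%E ->
    \int[mu]_s (c i * \1_(B i) s) = c i * fine (mu (B i)).
  move=> mu_fin; rewrite RintegralZl //; last first.
    apply: (@bounded_integrable _ _ _ _ mu_fin _ 1) => // s.
    exact: norm_indic_le1.
  by rewrite /Rintegral integral_indic // setIT.
have kVs x : \int[k x]_s Vs s = \sum_i c i * fine (k x (B i)).
  rewrite Rintegral_sum_integrable //.
    by apply: eq_bigr => i _; exact: Rint_indic.
  by move=> i; exact: (bounded_integrable (k_fin x) (mind i) (indK i)).
have k1 x i : 0 <= fine (k x (B i)) <= 1.
  rewrite fine_ge0 //= -lee_fin fineK; last first.
    rewrite ge0_fin_numE //; apply: le_lt_trans (k_lty x).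
    by apply: le_measure; rewrite ?inE.
  by rewrite -(k_fin x); apply: le_measure; rewrite ?inE.
have mk i : measurable_fun setT (fun w => fine (k (X w) (B i))).
  apply: (measurableT_comp (@fine_measurable R setT measurableT)).
  exact: (measurableT_comp (measurable_kernel k (B i) (mB i)) mX).
have mck i : measurable_fun setT (fun w => c i * fine (k (X w) (B i))).
  exact: measurable_funZ.
have ckK i w : `|c i * fine (k (X w) (B i))| <= `|c i|.
  rewrite normrM -[leRHS]mulr1 ler_wpM2l //.
  by have /andP[h0 h1] := k1 (X w) i; rewrite ger0_norm.
have mYind i : measurable_fun setT (fun w => c i * \1_(B i) (Y w)).
  exact: measurableT_comp (mind i) mY.
have int_simple : \int[P]_(w in E) Vs (Y w) =
                  \int[P]_(w in E) \int[k (X w)]_s Vs s.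
  under [RHS]eq_Rintegral do rewrite kVs.
  rewrite [LHS]Rintegral_sum_integrable //; last first.
    move=> i; exact: (bounded_integrable P_fin (mYind i) (fun w => indK i (Y w))).
  rewrite [RHS]Rintegral_sum_integrable //; last first.
    move=> i; exact: (bounded_integrable P_fin (mck i) (ckK i)).
  apply: eq_bigr => i _; rewrite [RHS]RintegralZl //; last first.
    apply: (@bounded_integrable _ _ _ _ P_fin _ 1) => // w.
    by have /andP[h0 h1] := k1 (X w) i; rewrite ger0_norm.
  have mYB : measurable (Y @^-1` B i) by rewrite -[X in measurable X]setTI; exact: mY.
  rewrite [LHS]RintegralZl //; last first.
    apply: (@bounded_integrable _ _ _ _ P_fin _ 1) => //.
      exact: measurableT_comp (measurable_indic _) mY.
    by move=> w; exact: norm_indic_le1.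
  congr (_ * _).
  rewrite /Rintegral; congr fine; rewrite (_ : (fun w => (\1_(B i) (Y w))%:E) =
     (fun w => (\1_(Y @^-1` B i) w)%:E)); last by apply/funext => w; rewrite !indicE.
  rewrite integral_indic // setIC; apply: etrans (law _ (mB i)) _.
  apply: eq_integral => w _; rewrite fineK // ge0_fin_numE //.
  apply: le_lt_trans (k_lty (X w)).
  by apply: le_measure; rewrite ?inE.
have mkVs : measurable_fun setT (fun w => \int[k (X w)]_s Vs s).
  by under eq_fun do rewrite kVs; exact: measurable_sum.
have d1 w : `|V (Y w) - Vs (Y w)| <= e by exact: VB.
have d2 w : `|\int[k (X w)]_s V s - \int[k (X w)]_s Vs s| <= e.
  have h : forall s, `|V s - Vs s| <= e := VB.
  have := normr_Rintegral_le (k_fin (X w)) measurableT (measurable_funB mV mVs) h.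
  rewrite RintegralB //.
    exact: (bounded_integrable (k_fin (X w)) mV VK).
  exact: (bounded_integrable (k_fin (X w)) mVs VsK).
have m1 := measurable_funB (measurableT_comp mV mY) (measurableT_comp mVs mY).
have m2 := measurable_funB mkV mkVs.
have := normr_Rintegral_le P_fin mE m1 d1.
have := normr_Rintegral_le P_fin mE m2 d2.
rewrite RintegralB //=; first last.
- apply: (@bounded_integrable _ _ _ _ P_fin _ (\sum_i `|c i|)) => // w.
  rewrite kVs; apply: le_trans (ler_norm_sum _ _ _) _; exact: ler_sum.
- apply: (@bounded_integrable _ _ _ _ P_fin _ K) => // w.
  exact: (normr_Rintegral_le (k_fin (X w)) measurableT mV VK).
move=> h2; rewrite RintegralB //; first last.
- exact: (bounded_integrable P_fin (measurableT_comp mVs mY) (fun w => VsK (Y w))).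
- exact: (bounded_integrable P_fin (measurableT_comp mV mY) (fun w => VK (Y w))).
move: h2; rewrite -int_simple !ler_norml => /andP[h1 h2] /andP[h3 h4].
by apply/andP; split; lra.
Qed.

End SubSigmaAlgebra.

(** * The self-normalized bound *)

Section MatrixMeasurability.
Context {R : realType} {dT : measure_display} {T : measurableType dT}.

Definition mx_measurable {m n} (M : T -> 'M[R]_(m, n)) :=
  forall i j, measurable_fun setT (fun x => M x i j).

Lemma mx_measurable_cst m n (M : 'M[R]_(m, n)) : mx_measurable (fun=> M).
Proof. by move=> i j; exact: measurable_cst. Qed.

Lemma mx_measurableD m n (M1 M2 : T -> 'M[R]_(m, n)) :
  mx_measurable M1 -> mx_measurable M2 -> mx_measurable (fun x => M1 x + M2 x).
Proof.
move=> m1 m2 i j; under eq_fun do rewrite mxE.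
by apply: measurable_funD; [exact: m1 | exact: m2].
Qed.

Lemma mx_measurableZ m n (c : T -> R) (M : T -> 'M[R]_(m, n)) :
  measurable_fun setT c -> mx_measurable M -> mx_measurable (fun x => c x *: M x).
Proof.
move=> mc mM i j; under eq_fun do rewrite mxE.
by apply: measurable_funM => //; exact: mM.
Qed.

Lemma mx_measurableM m n p (M1 : T -> 'M[R]_(m, n)) (M2 : T -> 'M[R]_(n, p)) :
  mx_measurable M1 -> mx_measurable M2 -> mx_measurable (fun x => M1 x *m M2 x).
Proof.
move=> m1 m2 i j; under eq_fun do rewrite mxE.
by apply: measurable_sum => k; apply: measurable_funM; [exact: m1 | exact: m2].
Qed.

Lemma mx_measurable_tr m n (M : T -> 'M[R]_(m, n)) :
  mx_measurable M -> mx_measurable (fun x => (M x)^T).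
Proof. by move=> mM i j; under eq_fun do rewrite mxE; exact: mM. Qed.

Lemma measurable_dotv d (u v : T -> 'cV[R]_d) :
  mx_measurable u -> mx_measurable v ->
  measurable_fun setT (fun x => dotv (u x) (v x)).
Proof.
by move=> mu mv; exact: (mx_measurableM (mx_measurable_tr mu) mv).
Qed.

(** Positivity of [K] keeps the denominator of the update at least 1, so its inverse is
    measurable. *)
Lemma mx_measurable_sm_update d (K : T -> 'M[R]_d) (phi : T -> 'cV[R]_d) :
  (forall x, psd (K x)) -> mx_measurable K -> mx_measurable phi ->
  mx_measurable (fun x => sm_update (K x) (phi x)).
Proof.
move=> pK mK mphi; rewrite /sm_update; under eq_fun do rewrite -scaleNr.
have mKphi := mx_measurableM mK mphi.
apply: mx_measurableD => //; apply: mx_measurableZ; last first.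
  by apply: mx_measurableM => //; exact: mx_measurable_tr.
apply: measurable_funN; apply: measurable_funV_gt0.
  by apply: measurable_funD => //; exact: measurable_dotv.
by move=> x; rewrite ltr_pwDl //; have [_] := pK x; apply.
Qed.

Lemma measurable_step_slope (q u : T -> R) : (forall x, 0 <= q x) ->
  measurable_fun setT q -> measurable_fun setT u ->
  measurable_fun setT (fun x => step_slope (q x) (u x)).
Proof.
move=> q0 mq mu.
have m1q : measurable_fun setT (fun x => 1 + q x) by exact: measurable_funD.
have mV : measurable_fun setT (fun x => (1 + q x)^-1).
  by apply: measurable_funV_gt0 => // x; rewrite ltr_pwDl.
have mk : measurable_fun setT (fun x => u x / (1 + q x)).
  exact: measurable_funM.
have mexp (f : T -> R) : measurable_fun setT f ->
    measurable_fun setT (fun x => expR (f x)).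
  exact: measurableT_comp.
apply: measurable_funM.
  apply: mexp; apply: measurable_funM => //; apply: measurable_funB.
    by apply: measurable_funM => //; apply: measurable_funB => //; exact: measurable_funX.
  exact: measurableT_comp (@measurable_ln R) m1q.
apply: measurable_funM => //; apply: measurable_funB; apply: mexp => //.
exact: measurable_funN.
Qed.

End MatrixMeasurability.

(** * The exponential supermartingale and its tail bound *)

Section SelfNormalizedBound.
Context {R : realType} {d0 : measure_display} {Omega : measurableType d0}.
Variables (P : probability Omega R) (d N : nat) (lam : R).
Variables (F G : nat -> set (set Omega)).
Variables (phi : nat -> Omega -> 'cV[R]_d) (eta : nat -> Omega -> R).
Hypothesis lam_gt0 : 0 < lam.
Hypothesis F_sub : forall t, F t `<=` measurable.
Hypothesis F_incr : forall t, F t `<=` F t.+1.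
Hypothesis G_sub : forall t, (1 <= t <= N)%N -> G t `<=` measurable.
Hypothesis F_subG : forall t, (t < N)%N -> F t `<=` <<s G t.+1 >>.
Hypothesis phi_adapted : forall t, (1 <= t <= N)%N ->
  mx_measurable (phi t : g_sigma_algebraType (F t) -> 'cV[R]_d).
Hypothesis phi_predictable : forall t, (1 <= t <= N)%N ->
  mx_measurable (phi t : g_sigma_algebraType (G t) -> 'cV[R]_d).
Hypothesis eta_adapted : forall t, (1 <= t <= N)%N ->
  measurable_fun setT (eta t : g_sigma_algebraType (F t) -> R).
Hypothesis eta_le1 : forall t w, (1 <= t <= N)%N -> `|eta t w| <= 1.
Hypothesis eta_centered : forall t, (1 <= t <= N)%N -> forall E, <<s G t >> E ->
  \int[P]_(w in E) eta t w = 0.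

Let K t w := gram_inv lam (phi^~ w) t.
Let S t w := noise_sum (phi^~ w) (eta^~ w) t.
Let q t w := leverage lam (phi^~ w) t.
Let u t w := drift lam (phi^~ w) (eta^~ w) t.
Let M t w := exp_potential lam (phi^~ w) (eta^~ w) t.

Let F_step t : F t `<=` <<s F t.+1 >>.
Proof. by move=> A /F_incr; exact: sub_sigma_algebra. Qed.

Let K_adapted t : (t <= N)%N ->
  mx_measurable (K t : g_sigma_algebraType (F t) -> 'M[R]_d).
Proof.
elim: t => [_|t IHt tN]; first exact: mx_measurable_cst.
have pK w : psd (K t w) by exact: gram_inv_psd.
have mK : mx_measurable (K t : g_sigma_algebraType (F t.+1) -> 'M[R]_d).
  move=> i j; apply: (measurable_fun_g_sigmaS (@F_step t)).
  exact: (IHt (ltnW tN) i j).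
have mphi : mx_measurable (phi t.+1 : g_sigma_algebraType (F t.+1) -> 'cV[R]_d).
  exact: phi_adapted.
exact: (mx_measurable_sm_update _ mK mphi).
Qed.

Let S_adapted t : (t <= N)%N ->
  mx_measurable (S t : g_sigma_algebraType (F t) -> 'cV[R]_d).
Proof.
elim: t => [_|t IHt tN].
  by rewrite /S /noise_sum; under eq_fun do rewrite big_geq //; exact: mx_measurable_cst.
rewrite /S; under eq_fun do rewrite noise_sumS.
have mS : mx_measurable (S t : g_sigma_algebraType (F t.+1) -> 'cV[R]_d).
  move=> i j; apply: (measurable_fun_g_sigmaS (@F_step t)).
  exact: (IHt (ltnW tN) i j).
apply: (mx_measurableD mS).
by apply: mx_measurableZ; [exact: eta_adapted | exact: phi_adapted].
Qed.

(** The sigma-algebra generated by [G t.+1] contains [F t] and makes the feature [t.+1] measurable,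
    while the noise [t.+1] is still centered over its events. *)
Let K_predictable t : (t < N)%N ->
  mx_measurable (K t : g_sigma_algebraType (G t.+1) -> 'M[R]_d).
Proof.
move=> tN i j; apply: (measurable_fun_g_sigmaS (F_subG tN)).
exact: (K_adapted (ltnW tN)).
Qed.

Let S_predictable t : (t < N)%N ->
  mx_measurable (S t : g_sigma_algebraType (G t.+1) -> 'cV[R]_d).
Proof.
move=> tN i j; apply: (measurable_fun_g_sigmaS (F_subG tN)).
exact: (S_adapted (ltnW tN)).
Qed.

Let q_predictable t : (t < N)%N ->
  measurable_fun setT (q t : g_sigma_algebraType (G t.+1) -> R).
Proof.
move=> tN; apply: measurable_dotv; first exact: phi_predictable.
by apply: mx_measurableM; [exact: K_predictable | exact: phi_predictable].
Qed.

Let u_predictable t : (t < N)%N ->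
  measurable_fun setT (u t : g_sigma_algebraType (G t.+1) -> R).
Proof.
move=> tN; apply: measurable_dotv; first exact: phi_predictable.
by apply: mx_measurableM; [exact: K_predictable | exact: S_predictable].
Qed.

Let q_adapted t : (t < N)%N ->
  measurable_fun setT (q t : g_sigma_algebraType (F t.+1) -> R).
Proof.
move=> tN; apply: measurable_dotv; first exact: phi_adapted.
apply: mx_measurableM; last exact: phi_adapted.
move=> i j; apply: (measurable_fun_g_sigmaS (@F_step t)).
exact: (K_adapted (ltnW tN)).
Qed.

Let L_adapted t : (t <= N)%N -> measurable_fun setT
  ((fun w => log_potential lam (phi^~ w) t) : g_sigma_algebraType (F t) -> R).
Proof.
elim: t => [_|t IHt tN]; rewrite /log_potential.
  by under eq_fun do rewrite big_ord0; exact: measurable_cst.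
under eq_fun do rewrite big_ord_recr /=.
apply: measurable_funD.
  exact: (measurable_fun_g_sigmaS (@F_step t) (IHt (ltnW tN))).
apply: (measurableT_comp (@measurable_ln R)).
by apply: measurable_funD => //; exact: q_adapted.
Qed.

Let M_adapted t : (t <= N)%N ->
  measurable_fun setT (M t : g_sigma_algebraType (F t) -> R).
Proof.
move=> tN; apply: (measurableT_comp (@measurable_expR R)).
apply: measurable_funM => //; apply: measurable_funB; last exact: L_adapted.
apply: measurable_dotv; first exact: S_adapted.
by apply: mx_measurableM; [exact: K_adapted | exact: S_adapted].
Qed.

Let M_le t w : (t <= N)%N -> M t w <= (1 + expR 1) ^+ t.
Proof.
move=> tN; apply: exp_potential_le => // i /andP[i1 it].
by apply: eta_le1; rewrite i1 (leq_trans it).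
Qed.

Let M_norm t w : (t <= N)%N -> `|M t w| <= (1 + expR 1) ^+ t.
Proof. by move=> tN; rewrite ger0_norm ?expR_ge0 // M_le. Qed.

Let M_measurable t : (t <= N)%N -> measurable_fun setT (M t).
Proof. by move=> /M_adapted; exact: measurable_fun_g_sigma. Qed.

Let P1 : (P setT = 1)%E := probability_setT P.

(** The supermartingale property in integrated form: by [exp_potential_step] the next value is at
    most the current one plus a predictable multiple [g] of the new noise, which integrates to
    zero. *)
Lemma exp_potential_expectation t : (t <= N)%N -> \int[P]_w M t w <= 1.
Proof.
elim: t => [_|t IHt tN].
  rewrite /M; under eq_Rintegral do rewrite exp_potential0.
  rewrite Rintegral_cst // mul1r (_ : fine _ = 1) //.
  exact: (congr1 fine P1).
apply: le_trans (IHt (ltnW tN)).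
pose g w := M t w * step_slope (q t w) (u t w).
have gK w : `|g w| <= (1 + expR 1) ^+ t * expR 1.
  rewrite normrM; apply: ler_pM; rewrite ?normr_ge0 //.
    exact: (M_norm w (ltnW tN)).
  by apply: step_slope_norm; exact: leverage_ge0.
have mg : measurable_fun setT (g : g_sigma_algebraType (G t.+1) -> R).
  apply: measurable_funM.
    exact: (measurable_fun_g_sigmaS (F_subG tN) (M_adapted (ltnW tN))).
  apply: measurable_step_slope; last exact: u_predictable.
    by move=> w; exact: leverage_ge0.
  exact: q_predictable.
have meta : measurable_fun setT (eta t.+1).
  by apply: measurable_fun_g_sigma (eta_adapted _).
have ge0 : \int[P]_w (g w * eta t.+1 w) = 0.
  apply: (Rintegral_mul_eq0 (G_sub (t := t.+1) _) meta _ mg gK) => //.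
    by move=> w; exact: eta_le1.
  exact: eta_centered.
have mgO : measurable_fun setT g.
  by apply: (measurable_fun_g_sigma _ mg); exact: G_sub.
have mge : measurable_fun setT (fun w => g w * eta t.+1 w) by exact: measurable_funM.
have geK w : `|g w * eta t.+1 w| <= (1 + expR 1) ^+ t * expR 1.
  rewrite normrM -[leRHS]mulr1; apply: ler_pM; rewrite ?normr_ge0 ?gK //.
  exact: eta_le1.
have iM := bounded_integrable P1 (M_measurable (ltnW tN))
  (fun w => M_norm w (ltnW tN)) measurableT.
have ige := bounded_integrable P1 mge geK measurableT.
have -> : \int[P]_w M t w = \int[P]_w (M t w + g w * eta t.+1 w).
  by rewrite RintegralD // ge0 addr0.
apply: le_Rintegral => //.
- exact: (bounded_integrable P1 (M_measurable tN) (fun w => M_norm w tN)).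
- by apply: eq_integrable (integrableD _ iM ige).
move=> w _.
have := @exp_potential_step R d lam (phi^~ w) lam_gt0 (eta^~ w) t
  (@eta_le1 t.+1 w tN).
move=> /le_trans; apply; rewrite le_eqVlt; apply/orP; left; apply/eqP.
by rewrite /g mulrDr mulr1 mulrA mulrAC.
Qed.

(* Markov's inequality applied to the nonnegative supermartingale
   [exp_potential] at the terminal time. *)
Lemma self_normalized_bound (delta : R) : 0 < delta ->
  exists E, [/\ measurable E, ((1 - delta)%:E <= P E)%E &
    forall w, E w -> noise_energy lam (phi^~ w) (eta^~ w) N <=
      log_potential lam (phi^~ w) N + 2 * ln delta^-1].
Proof.
move=> delta0; pose A := [set w | delta^-1 <= M N w].
have mA : measurable A.
  rewrite [A](_ : _ = M N @^-1` `[delta^-1, +oo[%classic); last first.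
    by apply/seteqP; split=> w /=; rewrite in_itv /= andbT.
  by rewrite -[X in measurable X]setTI; apply: M_measurable.
have PA : (P A <= delta%:E)%E.
  have PAfin : P A \is a fin_num by exact: fin_num_measure.
  rewrite -(fineK PAfin) lee_fin -[leRHS]mulr1 -ler_pdivrMl //.
  apply: le_trans (exp_potential_expectation (leqnn N)).
  have -> : delta^-1 * fine (P A) = \int[P]_w (delta^-1 * \1_A w).
    rewrite RintegralZl //; last exact: integrable_indic.
    by rewrite /Rintegral integral_indic // setIT.
  apply: le_Rintegral => //.
  - apply: (@bounded_integrable _ _ _ _ P1 _ `|delta^-1|) => // [|w].
      exact/measurable_funZ/measurable_indic.
    by rewrite normrM -[leRHS]mulr1 ler_wpM2l // norm_indic_le1.
  - apply: (bounded_integrable P1 (M_measurable _) (fun w => M_norm w _)) => //.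
  - move=> w _; rewrite indicE; case: (boolP (w \in A)) => /= [|_].
      by rewrite inE mulr1.
    by rewrite mulr0 expR_ge0.
exists (~` A); split; first exact: measurableC.
  rewrite probability_setC // EFinB leeB //.
move=> w /= /negP; rewrite -ltNge => h.
have : (noise_energy lam (phi^~ w) (eta^~ w) N
        - log_potential lam (phi^~ w) N) / 2 < ln delta^-1.
  by rewrite -ltr_expR lnK // posrE invr_gt0.
lra.
Qed.

End SelfNormalizedBound.

(** * Linear Markov decision processes *)

Lemma Rintegral_itv0 {R : realType} {dT : measure_display}
    {T : measurableType dT} (mu : {measure set T -> \bar R}) (f : T -> R) (B : R) :
  (mu setT = 1)%E -> measurable_fun setT f -> (forall x, 0 <= f x <= B) ->
  0 <= \int[mu]_x f x <= B.
Proof.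
move=> mu1 mf fB; apply/andP; split.
  by apply: Rintegral_ge0 => x _; have /andP[] := fB x.
apply: le_trans (ler_norm _) _; apply: normr_Rintegral_le => // x.
by have /andP[h0 h1] := fB x; rewrite ger0_norm.
Qed.

(** Adding [K] makes the integrand nonnegative, where measurability of kernel integrals applies; as
    the kernel has mass one, subtracting [K] undoes the shift. *)
Lemma measurable_Rintegral_pker {R : realType} {dS dA : measure_display}
    {S : measurableType dS} {A : measurableType dA} (k : R.-pker S ~> A)
    (f : S * A -> R) (K : R) :
  measurable_fun setT f -> (forall x, `|f x| <= K) ->
  measurable_fun setT (fun s => \int[k s]_a f (s, a)).
Proof.
move=> mf fK.
have mfa s : measurable_fun setT (fun a => f (s, a)).
  exact: measurableT_comp mf (pair1_measurable s).
have k1 s : (k s setT = 1)%E by rewrite prob_kernel.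
have mfK : measurable_fun setT (fun x => f x + K) by exact: measurable_funD.
have shift s : \int[k s]_a f (s, a) = \int[k s]_a (f (s, a) + K) - K.
  rewrite RintegralD //.
  - rewrite Rintegral_cst // (_ : fine _ = 1) ?mulr1 ?addrK //.
    exact: (congr1 fine (k1 s)).
  - exact: (bounded_integrable (k1 s) (mfa s) (fun a => fK (s, a))).
  - by apply: (@bounded_integrable _ _ _ _ (k1 s) _ `|K|).
under eq_fun do rewrite shift.
apply: measurable_funB => //.
apply: (measurableT_comp (@fine_measurable R setT measurableT)).
apply: (measurable_fun_integral_finite_kernel
          (fun x => (f x + K)%:E) k) => [x|].
  by rewrite lee_fin; have := fK x; rewrite ler_norml; lra.
exact/measurable_EFinP.
Qed.

(** The union bound. The predicates [Q k] are not assumed measurable, so each comes with a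
    measurable event inside it. *)
Lemma probability_bigcap_ge {R : realType} {d0 : measure_display}
    {Omega : measurableType d0} (P : probability Omega R) (n : nat) (e : R)
    (Q : nat -> Omega -> Prop) :
  (forall k, (k < n)%N -> exists E, [/\ measurable E, ((1 - e)%:E <= P E)%E &
     forall w, E w -> Q k w]) ->
  exists E, [/\ measurable E, ((1 - n%:R * e)%:E <= P E)%E &
     forall w, E w -> forall k, (k < n)%N -> Q k w].
Proof.
elim: n => [_|n IHn hQ].
  exists setT; split=> //; first by rewrite mul0r subr0 probability_setT.
have [|E1 [mE1 PE1 QE1]] := IHn; first by move=> k kn; exact/hQ/ltnW.
have [E2 [mE2 PE2 QE2]] := hQ n (ltnSn n).
exists (E1 `&` E2); split; first exact: measurableI.
  have E12 : E1 `&` E2 = ~` (~` E1 `|` ~` E2) by rewrite setCU !setCK.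
  have mC := measurableU _ _ (measurableC mE1) (measurableC mE2).
  rewrite E12 probability_setC //.
  have PU : (P (~` E1 `|` ~` E2) <= P (~` E1) + P (~` E2))%E.
    by apply: measureU2; exact: measurableC.
  have f1 : P E1 \is a fin_num by exact: fin_num_measure.
  have f2 : P E2 \is a fin_num by exact: fin_num_measure.
  have fU : P (~` E1 `|` ~` E2) \is a fin_num by exact: fin_num_measure.
  move: PU PE1 PE2; rewrite !probability_setC //.
  rewrite -(fineK f1) -(fineK f2) -(fineK fU).
  rewrite -!EFinB -EFinD !lee_fin -natr1; lra.
move=> w [/QE1 h1 /QE2 h2] k; rewrite ltnS leq_eqVlt => /predU1P[->|] //.
exact: h1.
Qed.

(** * Linear value functions under Bellman closedness *)

Section LinearMDP.
Context {R : realType} {dS dA : measure_display}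
  {S : measurableType dS} {A : measurableType dA} {d : nat}.
Variables (phi : S * A -> 'cV[R]_d) (p : R.-pker (S * A)%type ~> S)
  (pi : R.-pker S ~> A) (r : S * A -> R).
Hypothesis mphi : forall i j, measurable_fun setT (fun x => phi x i j).
Hypothesis phi1 : forall x, norm2 (phi x) <= 1.

Lemma measurable_dotv_feature w : measurable_fun setT (fun x => dotv (phi x) w).
Proof. by apply: measurable_dotv => //; exact: mx_measurable_cst. Qed.

Lemma dotv_feature_le w x : `|dotv (phi x) w| <= norm2 w.
Proof.
apply: le_trans (dotv_le_norm2 _ _) _.
by rewrite -[leRHS]mul1r ler_wpM2r ?norm2_ge0.
Qed.

Let pi1 s : (pi s setT = 1)%E.
Proof. by rewrite prob_kernel. Qed.

Let p1 x : (p x setT = 1)%E.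
Proof. by rewrite prob_kernel. Qed.

(** Writing a coordinate as a linear functional transfers the bounds on functionals to
    coordinates. *)
Let feature_coef x i : phi x i 0 = dotv (phi x) (delta_mx i 0).
Proof.
rewrite dotvE (bigD1 i) //= mxE !eqxx mulr1 big1 ?addr0 // => j /negbTE ji.
by rewrite mxE ji mulr0.
Qed.

Lemma dotv_phi_pi s w :
  dotv (phi_pi pi phi s) w = \int[pi s]_a dotv (phi (s, a)) w.
Proof.
have ms (v : 'cV[R]_d) : measurable_fun setT (fun a => dotv (phi (s, a)) v).
  exact: measurableT_comp (measurable_dotv_feature v) (pair1_measurable s).
have is_ (v : 'cV[R]_d) := bounded_integrable (pi1 s) (ms v)
  (fun a => dotv_feature_le v (s, a)) measurableT.
under eq_Rintegral do rewrite dotvE.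
have ic i : (pi s).-integrable setT (EFin \o (fun a => phi (s, a) i 0)).
  apply: eq_integrable (is_ (delta_mx i 0)) => // a _ /=.
  by rewrite feature_coef.
rewrite Rintegral_sum_integrable //.
  by rewrite dotvE; apply: eq_bigr => i _; rewrite mxE RintegralZr.
by move=> i; apply: eq_integrable (integrableZr _ (w i 0) (ic i)).
Qed.

Lemma measurable_dotv_phi_pi w :
  measurable_fun setT (fun s => dotv (phi_pi pi phi s) w).
Proof.
under eq_fun do rewrite dotv_phi_pi.
exact: (measurable_Rintegral_pker pi (measurable_dotv_feature w)
          (dotv_feature_le w)).
Qed.

Lemma dotv_phi_pi_le w s : `|dotv (phi_pi pi phi s) w| <= norm2 w.
Proof.
rewrite dotv_phi_pi; apply: normr_Rintegral_le => //.
  exact: measurableT_comp (measurable_dotv_feature w) (pair1_measurable s).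
by move=> a; exact: dotv_feature_le.
Qed.

Lemma dotv_nu0 (xi0 : probability S R) w : dotv (nu0 xi0 pi phi) w =
  \int[xi0]_s dotv (phi_pi pi phi s) w.
Proof.
have xi1 : (xi0 setT = 1)%E := probability_setT xi0.
have ic i : xi0.-integrable setT (EFin \o (fun s => phi_pi pi phi s i 0)).
  have := bounded_integrable xi1 (measurable_dotv_phi_pi (delta_mx i 0))
    (dotv_phi_pi_le (delta_mx i 0)) measurableT.
  apply: eq_integrable => // s _ /=; congr EFin.
  rewrite dotvE (bigD1 i) //= [X in _ * X]mxE !eqxx mulr1 big1 ?addr0 //.
  by move=> j /negbTE ji; rewrite [X in _ * X]mxE ji mulr0.
under eq_Rintegral do rewrite dotvE.
rewrite Rintegral_sum_integrable //.
  by rewrite dotvE; apply: eq_bigr => i _; rewrite mxE RintegralZr.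
by move=> i; apply: eq_integrable (integrableZr _ (w i 0) (ic i)).
Qed.

Hypothesis r01 : forall x, 0 <= r x <= 1.
Hypothesis r_linear : exists theta, forall x, r x = dotv (phi x) theta.
Hypothesis Ppi_closed : forall w, exists w', forall x,
  Ppi p pi (fun y => dotv (phi y) w) x = dotv (phi x) w'.

Let QkS k x : Qk p pi r k.+1 x = r x + Ppi p pi (Qk p pi r k) x.
Proof. by []. Qed.

(** [choice] turns closedness into a map [next] on parameters, iterated along the Bellman recursion.
    Parameters need not be unique, so [W 0 = 0] is recorded; the error recursion starts from it. *)
Lemma Qk_linear : exists W : nat -> 'cV[R]_d, W 0%N = 0 /\
  forall k x, Qk p pi r k x = dotv (phi x) (W k).
Proof.
have [theta rE] := r_linear; have [next nextE] := choice Ppi_closed.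
pose W k := iter k (fun w => theta + next w) 0.
exists W; split=> //; elim=> [|k IHk] x; first by rewrite dotv0.
have QE : Qk p pi r k = (fun y => dotv (phi y) (W k)).
  by apply/funext => y; exact: IHk.
rewrite [W k.+1]iterS dotvDr -rE -nextE -QE; exact: QkS.
Qed.

Lemma Ppi_dotv w x : Ppi p pi (fun y => dotv (phi y) w) x =
  \int[p x]_s dotv (phi_pi pi phi s) w.
Proof. by rewrite /Ppi; apply: eq_Rintegral => s _; rewrite dotv_phi_pi. Qed.

Variable W : nat -> 'cV[R]_d.
Hypothesis QW : forall k x, Qk p pi r k x = dotv (phi x) (W k).

Lemma Qk_succ k x : dotv (phi x) (W k.+1) =
  r x + \int[p x]_s dotv (phi_pi pi phi s) (W k).
Proof.
have QE : Qk p pi r k = (fun y => dotv (phi y) (W k)).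
  by apply/funext => y; exact: QW.
by rewrite -QW -Ppi_dotv -QE; exact: QkS.
Qed.

Lemma value_itv k s : (forall x, 0 <= dotv (phi x) (W k) <= k%:R) ->
  0 <= dotv (phi_pi pi phi s) (W k) <= k%:R.
Proof.
move=> h; rewrite dotv_phi_pi; apply: Rintegral_itv0 => //.
exact: measurableT_comp (measurable_dotv_feature _) (pair1_measurable s).
Qed.

Lemma Qk_itv k x : 0 <= dotv (phi x) (W k) <= k%:R.
Proof.
elim: k x => [|k IHk] x; first by rewrite -QW /Qk /= lexx.
rewrite Qk_succ -natr1; have := r01 x.
have : 0 <= \int[p x]_s dotv (phi_pi pi phi s) (W k) <= k%:R.
  apply: Rintegral_itv0 => //; first exact: measurable_dotv_phi_pi.
  by move=> s; exact: value_itv.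
lra.
Qed.

(** By [Qk_itv], [W k.+1] divided by [k.+1] is feasible in the maximization defining [omega]. *)
Lemma W_norm_le (omega : R) :
  (forall w, (forall x, 0 <= dotv (phi x) w <= 1) -> norm2 w <= omega) ->
  forall k, norm2 (W k.+1) <= k.+1%:R * omega.
Proof.
move=> homega k; have k0 : 0 < k.+1%:R :> R by rewrite ltr0n.
have kV : 0 <= k.+1%:R^-1 :> R by rewrite invr_ge0 ler0n.
have := homega (k.+1%:R^-1 *: W k.+1).
rewrite norm2Z (ger0_norm kV) ler_pdivrMl //; apply => x.
rewrite dotvZr; have /andP[h0 h1] := Qk_itv k.+1 x; apply/andP; split.
  exact: mulr_ge0.
by rewrite ler_pdivrMl // mulr1.
Qed.

Lemma vpiE (xi0 : probability S R) H :
  vpi xi0 p pi r H = dotv (nu0 xi0 pi phi) (W H.+1).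
Proof.
rewrite dotv_nu0 /vpi; apply: eq_Rintegral => s _; rewrite dotv_phi_pi.
by apply: eq_Rintegral => a _; exact: QW.
Qed.

(* The one-step temporal difference of the value function with [k + 1] stages
   to go, normalized by its range. *)
Definition td_noise k (x : S * A) (rew : R) (s' : S) : R :=
  (dotv (phi x) (W k.+1) - rew - dotv (phi_pi pi phi s') (W k)) / k.+1%:R.

(** The value with [k.+1] stages to go and the reward plus next value both lie in [[0, k.+1]], so
    their difference is at most [k.+1] in absolute value. *)
Lemma td_noise_le1 k x rew s' : 0 <= rew <= 1 -> `|td_noise k x rew s'| <= 1.
Proof.
move=> hr; have k0 : 0 < k.+1%:R :> R by rewrite ltr0n.
rewrite /td_noise normrM [`|_^-1|]gtr0_norm ?invr_gt0 // ler_pdivrMr // mul1r.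
have := Qk_itv k.+1 x; have := value_itv s' (Qk_itv k).
rewrite -natr1 ler_norml; lra.
Qed.

(** * Residuals of the regression recursion *)

Section Estimation.
Variables (lam : R) (N : nat) (x : nat -> S * A) (rew : nat -> R)
  (s' : nat -> S).
Hypothesis lam_gt0 : 0 < lam.
Hypothesis W0 : W 0%N = 0.
Let f t := phi (x t).
Let K := gram_inv lam f N.
Let Rh := R_hat lam N phi x rew.
Let Mh := M_hat pi lam N phi x s'.
Let noise k t := td_noise k (x t) (rew t) (s' t).

Lemma regression_residual k : W k.+1 - (Rh + Mh *m W k) =
  K *m (lam *: W k.+1 + k.+1%:R *: noise_sum f (noise k) N).
Proof.
have k0 : k.+1%:R != 0 :> R by rewrite pnatr_eq0.
have inv : invmx (Sigma_hat lam N phi x) = K by exact: invmx_gram.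
(* Inserting the Gram matrix and its inverse puts the true parameter under the same sum over data as
   the estimator; its [lam] part becomes the ridge bias. *)
have WE : W k.+1 = K *m (gram lam f N *m W k.+1).
  by rewrite mulmxA (mulmx1C (mul_gram_inv f lam_gt0 N)) mul1mx.
rewrite /Rh /R_hat /Mh /M_hat inv {1}WE -mulmxA -mulmxDr -mulmxBr; congr (_ *m _).
rewrite mulmxDl mul_scalar_mx -addrA; congr (_ + _).
rewrite !mulmx_suml /noise_sum scaler_sumr -big_split /= -sumrB.
apply: eq_bigr => t _; rewrite !mulmx_outer -scalerDl -scalerBl scalerA.
by congr (_ *: _); rewrite /noise /td_noise mulrC divfK // opprD addrA.
Qed.

(** The error with [k.+1] stages is a fresh residual plus [Mh] times the error with [k] stages.
    Moving [Mh] across the inner product replaces [nu] by [Mh^T *m nu], so the induction is over all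
    [nu]. *)
Lemma value_error_decomposition (nu : 'cV[R]_d) k :
  dotv nu (W k - iter k (fun w => Rh + Mh *m w) 0) =
  \sum_(0 <= h < k) dotv (nu_hat Mh nu h)
    (W (k - h)%N - (Rh + Mh *m W (k - h).-1)).
Proof.
elim: k nu => [|k IHk] nu; first by rewrite W0 /= subrr dotv0 big_geq.
rewrite iterS big_nat_recl // subn0 /= [_ - (Rh + _)](_ : _ =
  (W k.+1 - (Rh + Mh *m W k)) +
  Mh *m (W k - iter k (fun w => Rh + Mh *m w) 0)); last first.
  by rewrite mulmxBr !opprD !addrA subrK.
rewrite dotvDr dotv_mulmxr IHk; congr (_ + _).
apply: eq_bigr => h _; rewrite subSS; congr (dotv _ _).
exact: (esym (iterSr h (fun v => Mh^T *m v) nu)).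
Qed.

Lemma residual_bound (nu : 'cV[R]_d) (omega beta : R) k :
  norm2 (W k.+1) <= k.+1%:R * omega -> 0 <= omega ->
  Num.sqrt (noise_energy lam f (noise k) N) <= beta ->
  `|dotv nu (W k.+1 - (Rh + Mh *m W k))| <=
  k.+1%:R * Num.sqrt (dotv nu (invmx (Sigma_hat lam N phi x) *m nu)) *
  (Num.sqrt (2 * lam) * omega + beta).
Proof.
move=> Wk omega0 hbeta.
have -> : invmx (Sigma_hat lam N phi x) = K by exact: invmx_gram.
have pK : psd K by exact: gram_inv_psd.
rewrite regression_residual mulmxDr -!scalemxAr dotvDr !dotvZr.
apply: le_trans (ler_normD _ _) _; rewrite !normrM (gtr0_norm lam_gt0) normr_nat.
have CS1 := psd_normCauchySchwarz nu (W k.+1) pK.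
have CS2 := psd_normCauchySchwarz nu (noise_sum f (noise k) N) pK.
set a := Num.sqrt (dotv nu (K *m nu)) in CS1 CS2 *.
have a0 : 0 <= a by exact: sqrtr_ge0.
have k0 : 0 <= k.+1%:R :> R by exact: ler0n.
(* Since [K] is dominated by [lam^-1 I], the bias is at most [Num.sqrt lam * norm2 (W k.+1)]; [lam]
   is then enlarged to [2 * lam]. *)
have hW : lam * Num.sqrt (dotv (W k.+1) (K *m W k.+1)) <=
    k.+1%:R * (Num.sqrt (2 * lam) * omega).
  apply: le_trans (_ : Num.sqrt lam * norm2 (W k.+1) <= _).
    rewrite -[X in X * _ <= _](sqr_sqrtr (ltW lam_gt0)) expr2 -mulrA.
    rewrite ler_wpM2l ?sqrtr_ge0 // /norm2 -sqrtrM; last exact: ltW.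
    apply: ler_wsqrtr.
    by rewrite -ler_pdivlMl //; exact: gram_inv_le.
  apply: le_trans (ler_wpM2l (sqrtr_ge0 _) Wk) _.
  rewrite mulrCA ler_wpM2l // ler_wpM2r // ler_wsqrtr //.
  by rewrite mulr_natl mulr2n lerDl ltW.
rewrite mulrDr; apply: lerD.
  apply: le_trans (ler_wpM2l (ltW lam_gt0) CS1) _.
  rewrite mulrCA [leRHS](_ : _ = a * (k.+1%:R * (Num.sqrt (2 * lam) * omega))).
    by rewrite ler_wpM2l.
  by ring.
rewrite -mulrA ler_wpM2l //; apply: le_trans CS2 _.
by rewrite ler_wpM2l.
Qed.

End Estimation.
End LinearMDP.

(** * Constants of the confidence radius and centering of the noise *)

(** For [N, H >= 1], [3 N^2 H] is at least [3 / 2] times [H + 1]; the spare factor leaves the margin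
    [1 / 3 <= ln (3 / 2)]. *)
Lemma ln_confidence_le (R : realType) (N H : nat) (delta : R) :
  (0 < N)%N -> (0 < H)%N -> 0 < delta < 1 ->
  ln (delta / H.+1%:R)^-1 <= ln (3 * (N ^ 2)%:R * H%:R / delta) - 1 / 3.
Proof.
move=> N0 H0 /andP[delta0 delta1].
have H1 : 1 <= H%:R :> R by rewrite ler1n.
have N1 : 1 <= (N ^ 2)%:R :> R by rewrite ler1n expn_gt0 N0.
have H1' : 0 < H.+1%:R :> R by rewrite ltr0n.
have third : 1 / 3 <= ln (3 / 2) :> R.
  have := @ln1D_ge R (1 / 2) ltac:(lra).
  have -> : (1 / 2) / (1 + 1 / 2) = 1 / 3 :> R by field.
  by have -> : 1 + 1 / 2 = 3 / 2 :> R by field.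
rewrite lerBrDr; apply: le_trans (lerD (lexx _) third) _.
rewrite -lnM ?posrE ?invr_gt0 ?divr_gt0 // ler_ln ?posrE; last 2 first.
- by rewrite mulr_gt0 ?invr_gt0 ?divr_gt0.
- by rewrite divr_gt0 // !mulr_gt0 // ?ltr0n // expn_gt0 N0.
rewrite invf_div mulrAC ler_pM2r ?invr_gt0 // -natr1.
nra.
Qed.

Lemma confidence_radius_le (R : realType) (D L l : R) :
  0 <= D -> 0 <= l -> l <= L - 1 / 3 ->
  Num.sqrt (D + 2 * l) <= 2 * Num.sqrt (2 * D * L) + 4 / 3 * L.
Proof.
move=> D0 l0 lL; have L0 : 1 / 3 <= L by lra.
have X0 : 0 <= 2 * D * L by rewrite !mulr_ge0 //; lra.
set X := Num.sqrt (2 * D * L).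
have sX : X ^+ 2 = 2 * D * L by rewrite sqr_sqrtr.
have X1 : 0 <= X by exact: sqrtr_ge0.
have r0 : 0 <= 2 * X + 4 / 3 * L by lra.
rewrite -[leRHS](ger0_norm r0) -sqrtr_sqr; apply: ler_wsqrtr.
have -> : (2 * X + 4 / 3 * L) ^+ 2 =
    4 * X ^+ 2 + 16 / 3 * (X * L) + 16 / 9 * L ^+ 2 by field.
rewrite sX; have XL : 0 <= X * L by apply: mulr_ge0 => //; lra.
have DL : D * (1 / 3) <= D * L by apply: ler_wpM2l.
(* This square gives [16 / 9 * L ^+ 2 >= 2 * L - 9 / 16], which dominates [2 * l <= 2 * L - 2 / 3];
   the term [8 * D * L] dominates [D] because [L >= 1 / 3]. *)
have := sqr_ge0 (4 / 3 * L - 3 / 4).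
nra.
Qed.

(** Over the event [E], the reward integrates like [r] and the next value like its kernel average;
    the Bellman equation then cancels the two against the current value. *)
Lemma td_noise_centered {R : realType} {dS dA d0 : measure_display}
    {S : measurableType dS} {A : measurableType dA} {d : nat}
    {Omega : measurableType d0} (P : probability Omega R)
    (phi : S * A -> 'cV[R]_d) (p : R.-pker (S * A)%type ~> S)
    (pi : R.-pker S ~> A) (r : S * A -> R) (W : nat -> 'cV[R]_d) (k : nat)
    (X : Omega -> S * A) (rew : Omega -> R) (s' : Omega -> S) (E : set Omega) :
  (forall i j, measurable_fun setT (fun x => phi x i j)) ->
  (forall x, norm2 (phi x) <= 1) ->
  (forall x, 0 <= r x <= 1) -> measurable_fun setT r ->
  (forall k x, Qk p pi r k x = dotv (phi x) (W k)) ->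
  measurable_fun setT X -> measurable_fun setT rew -> measurable_fun setT s' ->
  (forall w, 0 <= rew w <= 1) -> measurable E ->
  (forall B, measurable B ->
     P (E `&` s' @^-1` B) = \int[P]_(w in E) p (X w) B)%E ->
  (\int[P]_(w in E) (rew w)%:E = \int[P]_(w in E) (r (X w))%:E)%E ->
  \int[P]_(w in E) td_noise phi pi W k (X w) (rew w) (s' w) = 0.
Proof.
move=> mphi phi1 r01 mr QW mX mrew ms' rew01 mE law mean.
have P1 : (P setT = 1)%E := probability_setT P.
pose V s := dotv (phi_pi pi phi s) (W k).
have mV : measurable_fun setT V by exact: measurable_dotv_phi_pi.
have VK s : `|V s| <= norm2 (W k) by exact: dotv_phi_pi_le.
(* The Bellman equation makes the kernel average explicit, which gives its measurability as well as
   the final cancellation. *)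
have PVE w : \int[p (X w)]_s V s = dotv (phi (X w)) (W k.+1) - r (X w).
  by rewrite (Qk_succ mphi phi1 QW) addrC addKr.
have mQ : measurable_fun setT (fun w => dotv (phi (X w)) (W k.+1)).
  exact: measurableT_comp (measurable_dotv_feature mphi _) mX.
have mrX : measurable_fun setT (fun w => r (X w)) by exact: measurableT_comp mr mX.
have mPV : measurable_fun setT (fun w => \int[p (X w)]_s V s).
  by under eq_fun do rewrite PVE; exact: measurable_funB.
have hV := Rintegral_kernel_law mX ms' mE law mV VK mPV.
have iQ := bounded_integrable P1 mQ
  (fun w => dotv_feature_le phi1 (W k.+1) (X w)) mE.
have irew : P.-integrable E (EFin \o rew).
  apply: (@bounded_integrable _ _ _ _ P1 _ 1) => // w.
  by have /andP[h0 h1] := rew01 w; rewrite ger0_norm.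
have irX : P.-integrable E (EFin \o (fun w => r (X w))).
  apply: (@bounded_integrable _ _ _ _ P1 _ 1) => // w.
  by have /andP[h0 h1] := r01 (X w); rewrite ger0_norm.
have iV := bounded_integrable P1 (measurableT_comp mV ms')
  (fun w => VK (s' w)) mE.
have iQr : P.-integrable E
    (EFin \o (fun w => dotv (phi (X w)) (W k.+1) - rew w)).
  by apply: eq_integrable (integrableB _ iQ irew).
rewrite /td_noise RintegralZr //; last first.
  by apply: eq_integrable (integrableB _ iQr iV).
rewrite RintegralB // RintegralB //.
have -> : \int[P]_(w in E) rew w = \int[P]_(w in E) r (X w).
  by rewrite /Rintegral mean.
rewrite -[X in _ - X]/(\int[P]_(w in E) V (s' w)) hV.
under [X in _ - X]eq_Rintegral do rewrite PVE.
by rewrite RintegralB // subrr mul0r.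
Qed.

Unset Implicit Arguments. Set Strict Implicit. Set Printing Implicit Defensive.

Theorem theorem4
  (R : realType) (dS dA d0 : measure_display)
  (S : measurableType dS) (A : measurableType dA)
  (Omega : measurableType d0) (P : probability Omega R)
  (d N H : nat)
  (phi : S * A -> 'cV[R]_d)
  (p : R.-pker (S * A)%type ~> S) (pi : R.-pker S ~> A)
  (xi0 : probability S R) (r : S * A -> R)
  (F : nat -> set (set Omega))
  (s : nat -> Omega -> S) (a : nat -> Omega -> A)
  (s' : nat -> Omega -> S) (rr : nat -> Omega -> R)
  (lam omega delta : R) :
  (* standing assumptions of the MDP setting *)
  (forall i j, measurable_fun setT (fun x => phi x i j)) ->
  (forall x, 0 <= r x <= 1) ->
  (* Assumption 1: r in Q and P^pi Q subset Q *)
  (exists theta : 'cV[R]_d, forall x, r x = dotv (phi x) theta) ->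
  (forall w : 'cV[R]_d, exists w' : 'cV[R]_d,
      forall x, Ppi p pi (fun y => dotv (phi y) w) x = dotv (phi x) w') ->
  (* lambda > 0, ||phi|| <= 1 *)
  0 < lam ->
  (forall x, norm2 (phi x) <= 1) ->
  (0 < N)%N -> (0 < H)%N ->
  (* data adapted to a filtration *)
  filtration F ->
  (forall tau t, (1 <= tau <= t)%N -> (t <= N)%N ->
     [/\ measurable_wrt (F t) (s tau), measurable_wrt (F t) (a tau),
         measurable_wrt (F t) (s' tau) & measurable_wrt (F t) (rr tau)]) ->
  (* conditionally on F_{t-1} and (s_t,a_t): s'_t ~ p(.|s_t,a_t),
     E[r'_t | .] = r(s_t,a_t), r'_t in [0,1] *)
  (forall t, (1 <= t <= N)%N ->
     let G := <<s [set E | F t.-1 E \/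
                  exists C : set (S * A)%type, measurable C /\
                    E = (fun w => (s t w, a t w)) @^-1` C] >> in
     [/\ (forall w, 0 <= rr t w <= 1),
         (forall E, G E -> forall B : set S, measurable B ->
            P (E `&` (s' t @^-1` B)) =
            integral P E (fun w => p (s t w, a t w) B)) &
         (forall E, G E ->
            integral P E (fun w => (rr t w)%:E) =
            integral P E (fun w => (r (s t w, a t w))%:E))]) ->
  (* omega = max { ||w||_2 : 0 <= phi(x)^T w <= 1 for all x } *)
  (exists w : 'cV[R]_d, (forall x, 0 <= dotv (phi x) w <= 1) /\ norm2 w = omega) ->
  (forall w : 'cV[R]_d, (forall x, 0 <= dotv (phi x) w <= 1) -> norm2 w <= omega) ->
  0 < delta < 1 ->
  let nu := nu0 xi0 pi phi in
  let v := vpi xi0 p pi r H in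
  let X := fun w t => (s t w, a t w) in
  let Sig := fun w => Sigma_hat lam N phi (X w) in
  let Rh := fun w => R_hat lam N phi (X w) (fun t => rr t w) in
  let Mh := fun w => M_hat pi lam N phi (X w) (fun t => s' t w) in
  let vhat := fun w => dotv nu (w_hat0 (Rh w) (Mh w) H) in
  let L := ln (3 * (N ^ 2)%:R * H%:R / delta) in
  let bound := fun w =>
    \sum_(0 <= h < H.+1)
       ((H - h + 1)%:R *
        Num.sqrt (dotv (nu_hat (Mh w) nu h) (invmx (Sig w) *m nu_hat (Mh w) nu h)) *
        (Num.sqrt (2 * lam) * omega
         + 2 * Num.sqrt (2 * d%:R * ln (1 + N%:R / (lam * d%:R)) * L)
         + 4 / 3 * L)) in
  exists E : set Omega, [/\ measurable E, (P E >= (1 - delta)%:E)%E &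
    forall w, E w -> `|v - vhat w| <= bound w].
Proof.
move=> mphi r01 r_linear Pclosed lam_gt0 phi1 N0 H0 filtF adapted cond
  [womega [womegaP omegaE]] omega_max delta01 nu v X Sig Rh Mh vhat L bound.
have [FS [F_sub F_incr]] := filtF.
have omega0 : 0 <= omega by rewrite -omegaE norm2_ge0.
have [W [W0 QW]] := Qk_linear r_linear Pclosed.
have mr : measurable_fun setT r.
  have [theta rE] := r_linear.
  rewrite (_ : r = (fun x => dotv (phi x) theta)); last exact/funext.
  exact: measurable_dotv_feature.
pose G t := [set E | F t.-1 E \/ exists C : set (S * A)%type, measurable C /\
  E = (fun w => (s t w, a t w)) @^-1` C].
have wrt (dT : measure_display) (T : measurableType dT) t (f : Omega -> T) :
    measurable_wrt (F t) f ->
    measurable_fun setT (f : g_sigma_algebraType (F t) -> T).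
  by move=> mf _ B mB; rewrite setTI; apply: sub_sigma_algebra; exact: mf.
have XF t : (1 <= t <= N)%N -> measurable_fun setT
    ((fun w => X w t) : g_sigma_algebraType (F t) -> (S * A)%type).
  move=> /andP[t1 tN].
  have [ms ma _ _] := adapted t t (introT andP (conj t1 (leqnn t))) tN.
  by apply: measurable_fun_pair; exact: wrt.
have XG t : measurable_fun setT
    ((fun w => X w t) : g_sigma_algebraType (G t) -> (S * A)%type).
  move=> _ B mB; rewrite setTI; apply: sub_sigma_algebra; right.
  by exists B.
have XO t : (1 <= t <= N)%N -> measurable_fun setT (fun w => X w t).
  by move=> /XF; exact: measurable_fun_g_sigma.
have s'F t : (1 <= t <= N)%N ->
    measurable_fun setT (s' t : g_sigma_algebraType (F t) -> S).
  move=> /andP[t1 tN].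
  have [_ _ ms' _] := adapted t t (introT andP (conj t1 (leqnn t))) tN.
  exact: wrt.
have rrF t : (1 <= t <= N)%N ->
    measurable_fun setT (rr t : g_sigma_algebraType (F t) -> R).
  move=> /andP[t1 tN].
  have [_ _ _ mrr] := adapted t t (introT andP (conj t1 (leqnn t))) tN.
  exact: wrt.
have G_sub t : (1 <= t <= N)%N -> G t `<=` measurable.
  move=> tN E [/F_sub//|[C [mC ->]]].
  by rewrite -[X in measurable X]setTI; exact: XO.
have F_subG t : (t < N)%N -> F t `<=` <<s G t.+1 >>.
  by move=> _ E FE; apply: sub_sigma_algebra; left.
pose eta k t w := td_noise phi pi W k (X w t) (rr t w) (s' t w).
have phi_adapted t : (1 <= t <= N)%N -> mx_measurable
    ((fun w => phi (X w t)) : g_sigma_algebraType (F t) -> 'cV[R]_d).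
  by move=> tN i j; exact: measurableT_comp (mphi i j) (XF t tN).
have phi_predictable t : (1 <= t <= N)%N -> mx_measurable
    ((fun w => phi (X w t)) : g_sigma_algebraType (G t) -> 'cV[R]_d).
  by move=> tN i j; exact: measurableT_comp (mphi i j) (XG t).
have eta_adapted k t : (1 <= t <= N)%N ->
    measurable_fun setT (eta k t : g_sigma_algebraType (F t) -> R).
  move=> tN; apply: measurable_funM => //; apply: measurable_funB.
    apply: measurable_funB; last exact: rrF.
    exact: measurableT_comp (measurable_dotv_feature mphi _) (XF t tN).
  exact: measurableT_comp (measurable_dotv_phi_pi pi mphi phi1 _) (s'F t tN).
have eta_le1 k t w : (1 <= t <= N)%N -> `|eta k t w| <= 1.
  move=> tN; have [rr01 _ _] := cond t tN.
  exact: (td_noise_le1 mphi phi1 r01 QW).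
have eta_centered k t : (1 <= t <= N)%N -> forall E, <<s G t >> E ->
    \int[P]_(w in E) eta k t w = 0.
  move=> tN E GE; have [rr01 law mean] := cond t tN.
  apply: (td_noise_centered (r := r)) => //.
  - exact: XO.
  - exact: (measurable_fun_g_sigma (F_sub t) (rrF t tN)).
  - exact: (measurable_fun_g_sigma (F_sub t) (s'F t tN)).
  - exact: (g_sigma_sub_measurable (G_sub t tN)).
  - by move=> B mB; exact: law.
  - exact: mean.
have /andP[delta0 delta1] := delta01.
have H1 : 0 < H.+1%:R :> R by rewrite ltr0n.
(* One event per stage [k = 0, ..., H], each failing with probability at most [delta / H.+1];
   together they fail with probability at most [delta]. *)
have [k _|E [mE PE noiseE]] := @probability_bigcap_ge _ _ _ P H.+1
    (delta / H.+1%:R) (fun k w =>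
      noise_energy lam (fun t => phi (X w t)) ((eta k)^~ w) N <=
      log_potential lam (fun t => phi (X w t)) N
      + 2 * ln (delta / H.+1%:R)^-1).
  apply: (self_normalized_bound (F := F) (G := G) lam_gt0 F_sub F_incr G_sub
    F_subG phi_adapted phi_predictable (eta_adapted k) (eta_le1 k)
    (eta_centered k)).
  exact: divr_gt0.
exists E; split=> //.
  by move: PE; rewrite mulrCA divff ?mulr1 // gt_eqF.
move=> w Ew.
have -> : v - vhat w = dotv nu (W H.+1 - iter H.+1 (fun y => Rh w + Mh w *m y) 0).
  by rewrite dotvBr /v (vpiE mphi phi1 QW).
rewrite (value_error_decomposition phi pi lam N (X w) (fun t => rr t w)
  (fun t => s' t w) W0).
apply: le_trans (ler_norm_sum _ _ _) _; rewrite /bound.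
rewrite [leLHS]big_nat_cond [leRHS]big_nat_cond.
apply: ler_sum => h /andP[/andP[_ hH] _].
(* Step [h] of the decomposition uses the residual at stage index [H - h], whose noise range
   [(H - h).+1] is the weight in the bound. *)
have -> : (H.+1 - h)%N = (H - h).+1 by rewrite subSn.
rewrite addn1 -addrA /=.
apply: residual_bound => //.
  exact: (W_norm_le mphi phi1 r01 QW).
have kH : (H - h < H.+1)%N by rewrite ltnS leq_subr.
have lconf := ln_confidence_le N0 H0 delta01.
have l0 : 0 <= ln (delta / H.+1%:R)^-1.
  rewrite ln_ge0 // invf_ge1 ?divr_gt0 // ler_pdivrMr // mul1r.
  by rewrite (le_trans (ltW delta1)) // ler1n.
have D0 : 0 <= d%:R * ln (1 + N%:R / (lam * d%:R)).
  rewrite mulr_ge0 // ln_ge0 // lerDl divr_ge0 // mulr_ge0 //.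
  exact: ltW.
(* The log-determinant is replaced by its dimension bound, so that [confidence_radius_le] applies
   with [D] this bound and [l] the confidence logarithm. *)
apply: le_trans (_ : Num.sqrt (d%:R * ln (1 + N%:R / (lam * d%:R))
    + 2 * ln (delta / H.+1%:R)^-1) <= _).
  apply: ler_wsqrtr; apply: le_trans (noiseE w Ew _ kH) _.
  by rewrite lerD2r; apply: log_potential_le.
rewrite -(mulrA 2 d%:R).
exact: confidence_radius_le.
Qed.
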